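(* Let $n,k,r$ be integers such that $k\geq 1$, $r\geq 2$, and $n\geq 256(k+1)^5r^{16}$. Then $$ar(n,F_{k+1,r})=\mathrm{ex}(n,F_{k,r})+2.$$
   Context: All graphs are finite and simple. For integers $k\ge 1$, $r\ge 2$, the $(k,r)$-fan $F_{k,r}$ is the graph on $(r-1)k+1$ vertices consisting of $k$ cliques, each with $r$ vertices, which intersect in exactly one common vertex (any two of the cliques share only that vertex). The Turán number $\mathrm{ex}(n,G)$ is the maximum number of edges of a graph on $n$ vertices containing no subgraph isomorphic to $G$ (not necessarily induced). An edge-coloring of a graph with exactly $m$ colors is an assignment of $m$ colors to its edges (adjacent edges may receive the same color) in which all $m$ colors are used. An edge-colored graph is rainbow if all its edges have distinct colors. The anti-Ramsey number $ar(n,G)$ is the minimum number of colors $m$ such that each edge-coloring of the complete graph $K_n$ with exactly $m$ colors contains a rainbow copy of $G$ (as a subgraph, not necessarily induced). *)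

(* Defs.v *)
From mathcomp Require Import all_boot.

Set Implicit Arguments.
Unset Strict Implicit.
Unset Printing Implicit Defensive.

(* A finite simple graph on the vertex type T is given by its edge set, a set *)
(* of two-element subsets of T.                                               *)
Section Graphs.
Variable T : finType.

Definition complete : {set {set T}} := [set e : {set T} | #|e| == 2].

Definition simple_graph (E : {set {set T}}) : bool := E \subset complete.

End Graphs.

Arguments complete T : clear implicits.

Section Copies.
Variables (U T : finType).

Definition copy (H : {set {set U}}) (f : {ffun U -> T}) : {set {set T}} :=
  [set f @: (e : {set U}) | e in H].

Definition contains (E : {set {set T}}) (H : {set {set U}}) : bool :=
  [exists f : {ffun U -> T}, injectiveb f && (copy H f \subset E)].

End Copies.

(* Edge colorings are total on {set T}, but only their values on the edges of *)
(* the complete graph are ever used.                                          *)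
Section Colorings.
Variables (T : finType) (m : nat).
Implicit Type c : {ffun {set T} -> 'I_m}.

Definition exact_coloring c : bool := c @: complete T == [set: 'I_m].

Definition rainbow c (E : {set {set T}}) : bool := dinjectiveb c [in E].

Definition contains_rainbow (U : finType) c (H : {set {set U}}) : bool :=
  [exists f : {ffun U -> T},
     [&& injectiveb f, copy H f \subset complete T & rainbow c (copy H f)]].

End Colorings.

Section Extremal.
Variables (n : nat) (U : finType) (H : {set {set U}}).

(* If H has no edge, the range may be empty and the value is then 0.          *)
Definition ex : nat :=
  \max_(E : {set {set 'I_n}} | simple_graph E && ~~ contains E H) #|E|.

(* The condition 0 < m matters: K_n with n >= 2 has no coloring with exactly  *)
(* 0 colors, so m = 0 would be admissible vacuously.                          *)
Definition forces_rainbow (m : nat) : bool :=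
  (0 < m) &&
  [forall c : {ffun {set 'I_n} -> 'I_m},
     exact_coloring c ==> contains_rainbow c H].

Lemma forces_rainbow_ex : exists m, forces_rainbow m.
Proof.
exists #|complete 'I_n|.+1; rewrite /forces_rainbow /=.
apply/forallP => c; apply/implyP => /eqP c_onto.
by have := leq_imset_card c [in complete 'I_n]; rewrite c_onto cardsT card_ord ltnn.
Qed.

Definition ar : nat := ex_minn forces_rainbow_ex.

End Extremal.

Section Fan.
Variables k r : nat.

(* None is the common vertex of the k cliques; Some (i, j) ranges over the    *)
(* r - 1 other vertices of the i-th clique.                                   *)
Definition fan_vertex : finType := option ('I_k * 'I_r.-1).

Definition fan_clique (i : 'I_k) : {set fan_vertex} :=
  None |: [set Some (i, j) | j : 'I_r.-1].

Definition fan : {set {set fan_vertex}} :=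
  [set e in complete fan_vertex | [exists i, e \subset fan_clique i]].

Lemma card_fan_vertex : #|fan_vertex| = (r.-1 * k).+1.
Proof. by rewrite card_option card_prod !card_ord mulnC. Qed.

Lemma card_fan_clique (i : 'I_k) : 0 < r -> #|fan_clique i| = r.
Proof.
move=> r_gt0; rewrite cardsU1 card_imset; last by move=> j j' [].
by rewrite card_ord; case: imsetP => [[]|_] //; rewrite add1n prednK.
Qed.

Lemma fan_cliqueI (i j : 'I_k) :
  i != j -> fan_clique i :&: fan_clique j = [set None].
Proof.
move=> neq_ij; apply/setP=> x; rewrite !inE; case: x => [[a b]|] //=.
apply/andP => -[/imsetP[u _ [-> _]] /imsetP[v _ [eq_ij _]]].
by rewrite eq_ij eqxx in neq_ij.
Qed.

End Fan.

(* Main.v *)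
Require Import Defs.
From mathcomp Require Import all_boot zify ring.
Set Implicit Arguments.
Unset Strict Implicit.
Unset Printing Implicit Defensive.

(** The number of colours ex + 1 does not suffice ([not_forced]): colour an
    extremal graph injectively and give all the other edges one new colour.

    For the converse let c be a colouring with ex + 2 colours and suppose that it
    has no rainbow fan with k + 1 cliques.  Then every rainbow graph is free of
    such fans; let G be a rainbow graph with ex + 2 edges.

    Suppose first that r = p + 1 with p > 1.  Planting a graph with maximum degree
    and matching number at most k - 1 in a class of the Turan graph creates no
    fan with k cliques ([sparse_ex]), so ex is at least the Turan number plus g,
    for a number g that bounds the number of edges of such a sparse graph; and G
    has at least two edges more than that.  After deletion of vertices of
    small degree ([dense_core]), G is nearly a complete p-partite graph: few edges
    are inside the classes, and then few edges between the classes are missing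
    ([partition_exists]).  In such a graph, fans centred at v correspond to stars
    at v inside the class of v together with matchings inside the other classes
    ([has_fan_fan_number]).  If no vertex is the centre of a fan with k cliques,
    the excess of inner over missing edges is at most g, and less than g if two
    classes contain inner edges ([inner_edges_bound]); this rests on the bound
    [edges_le_gallai] for the number of edges of a graph with given matching
    number, which comes from Gallai's lemma.

    Now the colours: choose pairs e1 and e2 of typical vertices inside two classes,
    and remove from G the edges with their colours.  Removing just the colour of
    e1 leaves a fan with k cliques, whose centre must lie in the class of e1, as e1
    would extend the fan otherwise; similarly for e2.  When both colours are
    removed no fan with k cliques is left, but the excess is still at least g.
    So all inner edges are in one class, and they contain a matching of
    size k - 1.  If that is not the class of e2, say, then the matching, e1, and
    the star e2 make an end of e2 the centre of a rainbow fan with k + 1 cliques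
    ([colour_argument]).

    If r = 2, fans are stars.  Each vertex sees at most k colours, at least one of
    which is big, i.e. appears at very many vertices.  Representatives of the
    small colours, and in addition some disjoint edges between vertices that
    see two big colours, form a graph of maximum degree less than k whose
    number of edges is at least the number of colours minus one
    ([star_colours_le]). *)

(** Cardinals and big sums are abstracted first: the linear arithmetic
    procedures are slow on goals that contain them. *)
Ltac arith_generalize :=
  repeat match goal with
         | H : is_true (leq _ _) |- _ => revert H
         | H : @eq nat _ _ |- _ => revert H
         end;
  repeat match goal with
         | |- context [@bigop.body ?R ?I ?a ?b ?c] =>
           let z := fresh "z" in set z := (@bigop.body R I a b c); clearbody z
         | |- context [@card.body ?T ?A] =>
           let z := fresh "z" in set z := (@card.body T A); clearbody z
         end; clear; intros.
Ltac slia := arith_generalize; lia.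
Ltac snia := arith_generalize; nia.

(** * Matchings and degrees *)
Section Matchings.
Variable T : finType.
Implicit Types (e f : {set T}) (G H M N : {set {set T}}) (u v w x y : T).

Definition star H v := [set e in H | v \in e].
Definition nbr H v := [set y | [set v; y] \in H].
Definition matching H M := (M \subset H) && trivIset M.
Definition matching_number H := \max_(M : {set {set T}} | matching H M) #|M|.

Lemma set2_complete x y : ([set x; y] \in complete T) = (x != y).
Proof. by rewrite inE cards2; case: (x == y). Qed.

Lemma edge_otherP e x :
  e \in complete T -> x \in e -> exists2 y, x != y & e = [set x; y].
Proof.
rewrite inE => /cards2P[a [b [neq_ab ->]]]; rewrite !inE.
case/orP=> /eqP->; first by exists b.
by exists a; rewrite 1?eq_sym // setUC.
Qed.

Lemma matching0 H : matching H set0.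
Proof. by rewrite /matching sub0set; apply/trivIsetP=> A B; rewrite inE. Qed.

Lemma leq_matching_number H M : matching H M -> #|M| <= matching_number H.
Proof. exact: leq_bigmax_cond. Qed.

Lemma matching_number_witness H : exists2 M, matching H M & #|M| = matching_number H.
Proof.
have [|M HM eM] := @eq_bigmax_cond _ (matching H) (fun M => #|M|).
  by apply/card_gt0P; exists set0; apply: matching0.
by exists M; rewrite // -eM.
Qed.

Lemma matchingS H H' M : H \subset H' -> matching H M -> matching H' M.
Proof. by move=> sHH' /andP[sMH ?]; apply/andP; split=> //; apply: subset_trans sHH'. Qed.

Lemma matching_number_mono H H' : H \subset H' -> matching_number H <= matching_number H'.
Proof.
move=> sHH'; have [M mM <-] := matching_number_witness H.
by apply/leq_matching_number/(matchingS sHH').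
Qed.

Lemma matching_sub H M N : N \subset M -> matching H M -> matching H N.
Proof.
move=> sNM /andP[sMH tM]; apply/andP; split; first exact: subset_trans sMH.
exact: trivIsetS tM.
Qed.

Lemma coverP M x : reflect (exists2 e, e \in M & x \in e) (x \in cover M).
Proof. by apply: (iffP bigcupP) => -[e]; exists e. Qed.

Lemma card_cover_matching H M :
  H \subset complete T -> matching H M -> #|cover M| = 2 * #|M|.
Proof.
move=> sH /andP[sMH /eqP <-]; rewrite (eq_bigr (fun=> 2)).
  by rewrite sum_nat_const mulnC.
by move=> e /(subsetP sMH)/(subsetP sH); rewrite inE => /eqP.
Qed.

Lemma card_cover_le H : H \subset complete T -> #|cover H| <= 2 * #|H|.
Proof.
move=> sH; apply: leq_trans (leq_card_cover H) _.
rewrite mulnC -sum_nat_const; apply: leq_sum => e /(subsetP sH).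
by rewrite inE => /eqP->.
Qed.

Lemma matching_add H M e :
  H \subset complete T -> matching H M -> e \in H ->
  [disjoint e & cover M] -> matching H (e |: M) /\ #|e |: M| = #|M|.+1.
Proof.
move=> sH /andP[sMH tM] eH dis.
have M0 : set0 \notin M.
  by apply/negP=> /(subsetP sMH)/(subsetP sH); rewrite inE cards0.
have [] // := @trivIsetU1 _ e M _ tM M0.
  move=> B BM; rewrite disjoint_subset; apply/subsetP=> z ze.
  rewrite inE; apply/negP=> zB; move/pred0P: dis => /(_ z) /=.
  by rewrite ze /=; move/negP; apply; apply/coverP; exists B.
move=> tU eM; split; last by rewrite cardsU1 eM.
by rewrite /matching tU subUset sub1set eH sMH.
Qed.

Lemma maximum_meets H M e :
  H \subset complete T -> matching H M -> #|M| = matching_number H -> e \in H ->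
  exists2 x, x \in e & x \in cover M.
Proof.
move=> sH mM cM eH; case: (boolP [disjoint e & cover M]) => [dis|].
  have [mM' cM'] := matching_add sH mM eH dis.
  by have := leq_matching_number mM'; rewrite cM' cM ltnn.
by rewrite -setI_eq0 => /set0Pn[x]; rewrite inE => /andP[]; exists x.
Qed.

Lemma nbr_star H v : H \subset complete T -> #|star H v| = #|nbr H v|.
Proof.
move=> sH; rewrite -(@card_in_imset _ _ (fun y => [set v; y]) (nbr H v)).
  apply: eq_card => e; rewrite inE; apply/andP/imsetP => [[eH ve]|[y]].
    have [y _ eE] := edge_otherP (subsetP sH _ eH) ve.
    by exists y; rewrite // inE -eE.
  by rewrite inE => yH ->; rewrite yH set21.
move=> y z; rewrite !inE => yH zH eq_yz.
have := subsetP sH _ yH; rewrite set2_complete => vy.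
have : y \in [set v; z] by rewrite -eq_yz set22.
by rewrite !inE eq_sym (negPf vy) => /eqP.
Qed.

Lemma sum_star H (A : {set T}) :
  \sum_(v in A) #|star H v| = \sum_(e in H) #|e :&: A|.
Proof.
have starE v : #|star H v| = \sum_(e in H) (v \in e).
  by rewrite -sum1_card -big_mkcondr; apply: eq_bigl => e; rewrite inE.
under eq_bigr do rewrite starE.
rewrite exchange_big /=; apply: eq_bigr => e _.
by rewrite -big_mkcondr sum1_card; apply: eq_card => x; rewrite !inE andbC.
Qed.

Lemma handshake H :
  H \subset complete T -> \sum_v #|star H v| = 2 * #|H|.
Proof.
move=> sH; have := sum_star H setT.
rewrite (eq_bigl xpredT) => [->|v]; last by rewrite inE.
rewrite (eq_bigr (fun=> 2)) ?sum_nat_const 1?mulnC // => e /(subsetP sH).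
by rewrite inE setIT => /eqP.
Qed.

Lemma card_rem_star H v : #|H| = #|H :\: star H v| + #|star H v|.
Proof.
rewrite addnC -(cardsID (star H v) H); congr (_ + _); apply: eq_card => e.
by rewrite !inE; case: (e \in H).
Qed.

(** By maximality every edge meets the cover of a maximum matching, and the
    edges of the matching meet it twice. *)
Lemma sum_star_cover H N :
  H \subset complete T -> matching H N -> #|N| = matching_number H ->
  #|H| + #|N| <= \sum_(v in cover N) #|star H v|.
Proof.
move=> sH mN cN.
rewrite sum_star.
have -> : #|N| = \sum_(e in H) (e \in N : nat).
  rewrite -sum1_card big_mkcond [RHS]big_mkcond /=; apply: eq_bigr => e _.
  case/andP: mN => sNH _; case: (boolP (e \in N)) => [/(subsetP sNH) ->//|_].
  by case: ifP.
rewrite -sum1_card -big_split /=; apply: leq_sum => e eH.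
case: (boolP (e \in N)) => [eN|_].
  have -> : 1 + 1 = #|e| by move: (subsetP sH _ eH); rewrite inE => /eqP->.
  by apply/subset_leq_card/subsetP=> x xe; rewrite inE xe /=; apply/coverP; exists e.
have [x xe xN] := maximum_meets sH mN cN eH.
by rewrite addn0; apply/card_gt0P; exists x; rewrite inE xe xN.
Qed.

(** The weight m v allows the vertex v to exceed the degree K - b.  This crude
    bound loses a factor two on the degrees, which is harmless when the
    matching number is 1 or when b = K. *)
Lemma edges_le_cover H K b (m : T -> nat) :
  H \subset complete T ->
  (forall v, #|star H v| + b <= K + m v) ->
  #|H| + matching_number H + 2 * matching_number H * b <= 2 * matching_number H * K + \sum_v m v.
Proof.
move=> sH dH; have [N mN cN] := matching_number_witness H.
have := sum_star_cover sH mN cN; rewrite cN => le1.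
have le2 : \sum_(v in cover N) (#|star H v| + b) <= \sum_(v in cover N) (K + m v).
  by apply: leq_sum => v _; apply: dH.
move: le2; rewrite !big_split /= !sum_nat_const (card_cover_matching sH mN) cN => le2.
have le3 : \sum_(v in cover N) m v <= \sum_v m v.
  by rewrite big_mkcond /=; apply: leq_sum => v _; case: ifP.
slia.
Qed.

(** The heart of Gallai's lemma: if some maximum matching misses w, then a
    maximum matching N misses at most one neighbour of w.  Among the maximum
    matchings that miss w take one, N1, that shares the most edges with N.
    Counting missed vertices gives x <> w missed by N1 and covered by N;
    exchanging an edge of N1 for the edge of N at x increases the overlap. *)
Lemma gallai_common_neighbour H N N' u v w :
  H \subset complete T -> matching H N -> matching H N' ->
  #|N| = matching_number H -> #|N'| = matching_number H ->
  w \notin cover N' -> u != v -> u \notin cover N -> v \notin cover N ->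
  [set u; w] \in H -> [set v; w] \in H -> False.
Proof.
move=> sH mN mN0 cN cN0 wN0 neq_uv uN vN uwH vwH.
pose P M := [&& matching H M, #|M| == matching_number H & w \notin cover M].
have P0 : P N' by rewrite /P mN0 cN0 eqxx.
have [N1 /and3P[mN1 /eqP cN1 wN1] maxN1] :
  exists2 M, P M & forall M', P M' -> #|N :&: M'| <= #|N :&: M|.
  by case: (arg_maxnP (fun M => #|N :&: M|) P0) => M; exists M.
have cov1 x y : [set x; y] \in H -> x \notin cover N1 -> y \in cover N1.
  move=> xyH xN1; have [z] := maximum_meets sH mN1 cN1 xyH.
  by case/set2P=> -> //; move/negP: xN1.
have uN1 : u \in cover N1 by apply: (cov1 w); rewrite // setUC.
have vN1 : v \in cover N1 by apply: (cov1 w); rewrite // setUC.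
have [x [xN xN1 xw]] : exists x, [/\ x \in cover N, x \notin cover N1 & x != w].
  pose A := cover N1 :\: cover N; pose B := cover N :\: cover N1.
  have eqAB : #|A| = #|B|.
    have cov_card M :
        matching H M -> #|M| = matching_number H -> #|cover M| = 2 * matching_number H.
      by move=> mM cM; rewrite (card_cover_matching sH mM) cM.
    apply: (@addnI #|cover N1 :&: cover N|); rewrite cardsID cov_card //.
    by rewrite setIC cardsID cov_card.
  have : 1 < #|B|.
    rewrite -eqAB; apply: leq_trans (subset_leq_card (_ : [set u; v] \subset A)).
      by rewrite cards2 neq_uv.
    by rewrite subUset !sub1set !inE uN vN uN1 vN1.
  case/card_gt1P=> x [y [xB yB neq_xy]].
  have [xw|xw] := eqVneq x w; last first.
    by exists x; move: xB; rewrite inE => /andP[].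
  by exists y; move: yB; rewrite inE -xw eq_sym neq_xy => /andP[].
have [e eN xe] := coverP _ _ xN.
have sub M : matching H M -> M \subset H by case/andP.
have eH := subsetP (sub _ mN) _ eN.
have [y xy eE] := edge_otherP (subsetP sH _ eH) xe.
have yN1 : y \in cover N1 by apply: (cov1 x); rewrite // -eE.
have [f fN1 yf] := coverP _ _ yN1.
have fN : f \notin N.
  apply/negP=> fN; case/andP: mN => _ /trivIsetP tN.
  case: (eqVneq e f) => [ef|ef].
    by move/negP: xN1; apply; apply/coverP; exists e; rewrite // ef.
  have /pred0P/(_ y) /= := tN _ _ eN fN ef.
  by rewrite yf eE set22.
have mF : matching H (N1 :\ f) by apply: matching_sub mN1; apply: subD1set.
have dis : [disjoint e & cover (N1 :\ f)].
  apply/pred0P=> z /=; apply/negP=> /andP[]; rewrite eE !inE.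
  case/orP=> /eqP-> /coverP[h]; rewrite !inE => /andP[hf hN1].
    by move=> xh; move/negP: xN1; apply; apply/coverP; exists h.
  move=> yh; case/andP: mN1 => _ /trivIsetP tN1.
  by have /pred0P/(_ y) /= := tN1 _ _ hN1 fN1 hf; rewrite yh yf.
have [mN2 cN2] := matching_add sH mF eH dis.
have : P (e |: N1 :\ f).
  apply/and3P; split=> //.
    by rewrite cN2 -cN1 (cardsD1 f N1) fN1.
  apply/negP=> /coverP[h]; rewrite !inE => /orP[/eqP->|/andP[_ hN1] wh].
    rewrite eE !inE eq_sym (negPf xw) /= => /eqP wy.
    by move: wN1; rewrite wy yN1.
  by move/negP: wN1; apply; apply/coverP; exists h.
move/maxN1; apply/negP; rewrite -ltnNge; apply: proper_card.
apply/properP; split.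
  apply/subsetP=> h; rewrite !inE => /andP[hN hN1]; rewrite hN hN1 andbT /=.
  by apply/orP; right; apply: contraNneq fN => <-.
exists e; first by rewrite !inE eN eqxx.
rewrite inE eN /=; apply/negP=> eN1.
by move/negP: xN1; apply; apply/coverP; exists e.
Qed.

(** Sharper than [edges_le_cover]: the average number of edges per matching
    edge is about K - b / 2, because a vertex either lies in every maximum
    matching, and is paid for by the mean of its two degree bounds when it is
    deleted, or can be missed.  Once every vertex can be missed, the vertices
    outside a maximum matching N send at most one edge to each vertex covered
    by N, by [gallai_common_neighbour], so they cost at most 2 per edge of N. *)
Lemma edges_le_gallai H K b (m : T -> nat) :
  H \subset complete T -> 2 <= b <= K ->
  (forall v, #|star H v| <= K) -> (forall v, #|star H v| + b <= K + m v) ->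
  2 * #|H| + matching_number H * b <= 2 * matching_number H * K + \sum_v m v.
Proof.
move=> sH /andP[b2 bK].
have [l] := ubnP #|H|; elim: l H m sH => // l IHl H m sH lH dK dm.
pose essential v := [forall N : {set {set T}},
  (matching H N && (#|N| == matching_number H)) ==> (v \in cover N)].
have essP v N : essential v -> matching H N -> #|N| = matching_number H -> v \in cover N.
  by move=> /forallP/(_ N)/implyP es mN cN; apply: es; rewrite mN cN eqxx.
have [N mN cN] := matching_number_witness H.
have cov := card_cover_matching sH mN; rewrite cN in cov.
case: (pickP essential) => [v es|none].
  have [e eN ve] := coverP _ _ (essP _ _ es mN cN).
  have eH : e \in H by case/andP: mN => /subsetP sNH _; apply: sNH.
  have cH := card_rem_star H v.
  have d_gt0 : 0 < #|star H v| by apply/card_gt0P; exists e; rewrite inE eH.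
  pose H' := H :\: star H v; pose m' x := if x == v then 0 else m x.
  have sH' : H' \subset H by apply: subsetDl.
  have sSt x : #|star H' x| <= #|star H x|.
    by apply: subset_leq_card; apply/subsetP=> h; rewrite !inE => /andP[/andP[_ ->]].
  have matching_number' : matching_number H' < matching_number H.
    have [M mM cM] := matching_number_witness H'.
    rewrite ltn_neqAle matching_number_mono // andbT; apply/eqP => eq_nu.
    have := essP _ M es (matchingS sH' mM); rewrite cM eq_nu => /(_ erefl)/coverP[h hM vh].
    case/andP: mM => /subsetP/(_ _ hM); rewrite !inE vh andbT => /andP[].
    by case: (h \in H).
  have star'v : #|star H' v| = 0.
    apply/eqP; rewrite cards_eq0; apply/eqP/setP=> h; rewrite !inE.
    by case: (h \in H); case: (v \in h).
  have := IHl H' m'; rewrite (subset_trans sH' sH) => /(_ isT).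
  have lH' : #|H'| < l by rewrite cH -/H' in lH; lia.
  move=> /(_ lH').
  have dK' x : #|star H' x| <= K by apply: leq_trans (sSt x) (dK x).
  move=> /(_ dK').
  have dm' x : #|star H' x| + b <= K + m' x.
    rewrite /m'; case: eqVneq => [->|_]; first by rewrite star'v; lia.
    by have := sSt x; have := dm x; lia.
  move=> /(_ dm') IH.
  have sm : \sum_x m x = \sum_x m' x + m v.
    rewrite (bigD1 v) //= [in RHS](bigD1 v) //= {1}/m' eqxx add0n addnC.
    by congr (_ + _); apply: eq_bigr => x /negPf xv; rewrite /m' xv.
  rewrite sm cH -/H'; have := dK v; have := dm v; snia.
have notess w : exists M, [/\ matching H M, #|M| = matching_number H & w \notin cover M].
  have /negbT := none w; rewrite negb_forall => /existsP[M].
  by rewrite negb_imply => /andP[/andP[mM /eqP cM] wM]; exists M.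
have le1 : \sum_(v in cover N) (#|star H v| + b) <= \sum_(v in cover N) (K + m v).
  by apply: leq_sum => v _; apply: dm.
move: le1; rewrite !big_split /= !sum_nat_const cov => le1.
have le2 : \sum_(v in cover N) m v <= \sum_v m v.
  by rewrite big_mkcond /=; apply: leq_sum => v _; case: ifP.
have le3 : \sum_(v | v \notin cover N) #|star H v| <= 2 * matching_number H.
  under eq_bigr do rewrite nbr_star // -sum1_card big_mkcond /=.
  rewrite exchange_big /= -cov -sum1_card [leqRHS]big_mkcond /=.
  apply: leq_sum => y _; rewrite -big_mkcondr /= sum1_card.
  case: ifPn => yN.
    have [M [mM cM yM]] := notess y.
    rewrite leqNgt; apply/negP=> /card_gt1P[u [v []]].
    move=> /andP[uN]; rewrite inE => uH /andP[vN]; rewrite inE => vH neq_uv.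
    exact: (gallai_common_neighbour sH mN mM cN cM yM neq_uv uN vN).
  rewrite leqn0; apply/pred0P=> v; apply/negP=> /andP[vN]; rewrite inE => vH.
  have [z] := maximum_meets sH mN cN vH.
  by case/set2P=> ->; apply/negP.
have := handshake sH; rewrite (bigID (mem (cover N))) /= => hs.
snia.
Qed.

End Matchings.

(** * Fans as families of cliques *)
Section Fans.
Variable T : finType.
Implicit Types (e f C : {set T}) (G : {set {set T}}) (u v w x y : T).

Definition clique G C :=
  [forall x in C, forall y in C, (x != y) ==> ([set x; y] \in G)].

Lemma cliqueP G C :
  reflect {in C &, forall x y, x != y -> [set x; y] \in G} (clique G C).
Proof.
apply: (iffP forall_inP) => [h x y xC yC xy|h x xC].
  by have /forall_inP/(_ y yC)/implyP := h x xC; apply.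
by apply/forall_inP=> y yC; apply/implyP; apply: h.
Qed.

Lemma cliqueS G C C' : C \subset C' -> clique G C' -> clique G C.
Proof.
by move=> /subsetP s /cliqueP h; apply/cliqueP=> x y /s xC /s yC; apply: h.
Qed.

Lemma clique_setU1 G C x :
  clique G C -> {in C, forall y, [set x; y] \in G} -> clique G (x |: C).
Proof.
move=> /cliqueP cC h; apply/cliqueP=> a b; rewrite !in_setU1.
case/orP=> [/eqP->|aC] /orP[/eqP->|bC] ab; rewrite ?eqxx // in ab *.
- exact: h.
- by rewrite setUC; apply: h.
- exact: cC.
Qed.

(** A fan with k cliques of s + 1 vertices, given by its centre v and the
    cliques C i with v removed. *)
Definition has_fan G k s :=
  exists v (C : 'I_k -> {set T}),
    [/\ forall i, #|C i| = s, forall i, v \notin C i,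
        forall i, clique G (v |: C i) & forall i j, i != j -> [disjoint C i & C j]].

Lemma has_fan_family (I : finType) (J : {set I}) G k s v (C : I -> {set T}) :
  k <= #|J| ->
  {in J, forall i, [/\ #|C i| = s, v \notin C i & clique G (v |: C i)]} ->
  {in J &, forall i j, i != j -> [disjoint C i & C j]} ->
  has_fan G k s.
Proof.
move=> kJ hC dC; pose h (i : 'I_k) := enum_val (widen_ord kJ i).
have hJ i : h i \in J by apply: enum_valP.
exists v, (C \o h); split=> [i|i|i|i j ij] /=; try by case: (hC _ (hJ i)).
by apply: dC => //; apply: contraNneq ij => /enum_val_inj/(congr1 val) /= /ord_inj ->.
Qed.

Lemma has_fanS G G' k s : G \subset G' -> has_fan G k s -> has_fan G' k s.
Proof.
move=> /subsetP sG [v [C [h1 h2 h3 h4]]]; exists v, C; split=> // i.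
apply/cliqueP=> x y xC yC xy; apply/sG.
by have /cliqueP := h3 i; apply.
Qed.

Lemma fan_edge k r (i : 'I_k) (a b : fan_vertex k r) :
  a \in fan_clique r i -> b \in fan_clique r i -> a != b ->
  [set a; b] \in fan k r.
Proof.
move=> aC bC ab; rewrite inE set2_complete ab /=; apply/existsP; exists i.
by rewrite subUset !sub1set aC bC.
Qed.

Lemma contains_fanP G k r :
  reflect (has_fan G k r.-1) (contains G (fan k r)).
Proof.
apply: (iffP existsP) => [[f /andP[/injectiveP f_inj /subsetP fG]]|].
  pose C i := f @: [set Some (i, j) | j : 'I_r.-1].
  have NC i : f None \notin C i.
    by apply/imsetP=> -[x /imsetP[j _ ->]] /f_inj.
  have CE i : f None |: C i = f @: fan_clique r i by rewrite imsetU1.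
  exists (f None), C; split=> // [i|i|i j ij].
  - rewrite !card_imset ?card_ord //; by move=> j j' [].
  - apply/cliqueP=> x y; rewrite CE => /imsetP[a aC ->] /imsetP[b bC ->] ab.
    have -> : [set f a; f b] = f @: [set a; b] by rewrite imsetU1 imset_set1.
    apply: fG; apply: imset_f; apply: fan_edge aC bC _.
    by apply: contraNneq ab => ->.
  - apply/pred0P=> x /=; apply/negP=> /andP[/imsetP[a /imsetP[ja _ ->] ->]].
    case/imsetP=> b /imsetP[jb _ ->] /f_inj [eij _].
    by rewrite eij eqxx in ij.
case=> v [C [cC vC clC dC]].
pose f : {ffun fan_vertex k r -> T} := [ffun x : fan_vertex k r =>
  if x is Some ij then enum_val (cast_ord (esym (cC ij.1)) ij.2) else v].
have fS i j : f (Some (i, j)) \in C i by rewrite ffunE; apply: enum_valP.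
have fN : f None = v by rewrite ffunE.
have fC i (x : fan_vertex k r) : x \in fan_clique r i -> f x \in v |: C i.
  rewrite in_setU1; case/setU1P=> [->|/imsetP[j _ ->]]; first by rewrite fN eqxx.
  by rewrite fS orbT.
have f_inj : injective f.
  move=> [[i j]|] [[i' j']|] //.
  - move=> eq_f; have [eii|neq] := eqVneq i i'; last first.
      have /pred0P/(_ (f (Some (i, j)))) /= := dC _ _ neq.
      by rewrite fS {1}eq_f fS.
    move: eq_f; rewrite -{}eii !ffunE /= => /enum_val_inj/(congr1 val) /= /ord_inj.
    by move=> ->.
  - by rewrite fN => eq_f; move: (vC i); rewrite -eq_f fS.
  - by rewrite fN => eq_f; move: (vC i'); rewrite eq_f fS.
exists f; apply/andP; split; first exact/injectiveP.
apply/subsetP=> e' /imsetP[e]; rewrite inE => /andP[ce /existsP[i /subsetP ei]] ->.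
have [x xe] : exists x : fan_vertex k r, x \in e.
  by apply/card_gt0P; move: ce; rewrite inE => /eqP->.
have [y xy eE] := edge_otherP ce xe.
rewrite eE imsetU1 imset_set1.
have /cliqueP := clC i; apply.
- by apply/fC/ei.
- by apply/fC/ei; rewrite eE set22.
- by rewrite (inj_eq f_inj).
Qed.

(** The (k,2)-fan is a star with k edges. *)
Lemma has_fan_starP G k : G \subset complete T ->
  reflect (has_fan G k 1) [exists v, k <= #|star G v|].
Proof.
move=> sG; apply: (iffP existsP) => [[v]|[v [C [cC vC clC dC]]]].
  rewrite nbr_star // => kv.
  apply: (@has_fan_family _ (nbr G v) _ _ _ v (fun y => [set y])) => //.
    move=> y; rewrite [y \in _]inE => vy; split; first exact: cards1.
      by apply/set1P=> vE; move: (subsetP sG _ vy); rewrite set2_complete vE eqxx.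
    apply: clique_setU1 => [|z]; last by move/set1P->.
    by apply/cliqueP=> a b /set1P-> /set1P->; rewrite eqxx.
  move=> y z _ _ yz; apply/pred0P=> x /=; rewrite !inE.
  by apply/negP=> /andP[/eqP->]; apply/negP.
exists v; rewrite nbr_star //.
have c1 i : exists y, C i == [set y] by have /eqP/cards1P[y ->] := cC i; exists y.
pose h i := xchoose (c1 i).
have hE i : C i = [set h i] by apply/eqP; apply: xchooseP (c1 i).
rewrite -[X in X <= _]card_ord -(@card_imset _ _ h).
  apply: subset_leq_card; apply/subsetP=> _ /imsetP[i _ ->]; rewrite inE.
  have /cliqueP := clC i; apply; rewrite ?hE ?inE ?eqxx ?orbT //.
  by have := vC i; rewrite hE inE.
move=> i j hij; apply/eqP; apply: contraT => /dC.
by rewrite !hE hij => /pred0P/(_ (h j)); rewrite /= !inE eqxx.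
Qed.

End Fans.

(** * A lower bound for the extremal number *)
Section Parts.
Variables (T I : finType).
Implicit Types (e : {set T}) (W : {set T}).

Definition mono (pi : T -> I) e := [forall x in e, forall y in e, pi x == pi y].

(** The edges of the complete multipartite graph whose classes are the fibres
    of pi on W. *)
Definition cross W (pi : T -> I) :=
  [set e in complete T | (e \subset W) && ~~ mono pi e].

Lemma mono_pair pi x y : mono pi [set x; y] = (pi x == pi y).
Proof.
apply/forall_inP/eqP => [h|xy].
  by have /forall_inP/(_ y (set22 _ _))/eqP := h x (set21 _ _).
by move=> a /set2P[]->; apply/forall_inP=> b /set2P[]->; rewrite ?xy eqxx.
Qed.

End Parts.

(** The Turan number for cliques on p + 1 vertices, as a maximum over all
    partitions of W: the sizes of the classes of an optimal partition are never
    needed. *)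
Definition turan p (T : finType) (W : {set T}) :=
  \max_(pi : {ffun T -> 'I_p}) #|cross W pi|.

Lemma inj_in_exists (T U : finType) (A : {set T}) (B : {set U}) (u0 : U) :
  #|A| <= #|B| ->
  exists2 h : T -> U, {in A &, injective h} & {in A, forall x, h x \in B}.
Proof.
move=> AB; exists (fun x => nth u0 (enum B) (index x (enum A))).
  move=> x y xA yA /eqP; rewrite nth_uniq ?enum_uniq //.
  - by move/eqP/index_inj => -> //; rewrite mem_enum.
  - by rewrite -cardE; apply: leq_trans AB; rewrite cardE index_mem mem_enum.
  - by rewrite -cardE; apply: leq_trans AB; rewrite cardE index_mem mem_enum.
move=> x xA; rewrite -mem_enum mem_nth // -cardE; apply: leq_trans AB.
by rewrite cardE index_mem mem_enum.
Qed.

(** Plant H in one class V i0 of an optimal p-partite graph; pigeonhole gives a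
    class with enough room.  A clique on p + 1 vertices has two vertices in the
    same class, hence contains an edge of the planted copy.  So a fan with k
    cliques yields k edges of H at its centre, when the centre lies in V i0,
    and k disjoint edges of H otherwise. *)
Lemma sparse_ex (T : finType) (H : {set {set T}}) n k p :
  0 < k -> 0 < p -> H \subset complete T ->
  (forall v, #|star H v| < k) -> matching_number H < k -> #|cover H| * p <= n ->
  #|H| + turan p [set: 'I_n] <= ex n (fan k p.+1).
Proof.
move=> k0 p0 sH dH nuH; have [n0|n0] := posnP n.
  move=> small; have H0 : H = set0.
    apply/eqP; rewrite -subset0; apply/subsetP=> e eH.
    have: cover H == set0 by rewrite -cards_eq0; move: small; rewrite n0; nia.
    have /card_gt0P[x xe] : 0 < #|e| by move: (subsetP sH _ eH); rewrite inE => /eqP->.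
    by move/eqP/setP/(_ x); rewrite inE => /negP; case; apply/coverP; exists e.
  rewrite H0 cards0 /turan; apply/bigmax_leqP=> pi _.
  have -> : cross [set: 'I_n] pi = set0; last by rewrite cards0.
  apply/setP=> e; rewrite !inE; apply/negP=> /andP[/eqP ce _].
  by have := max_card (mem e); rewrite card_ord ce n0.
move=> small.
have p0' : 0 < #|{ffun 'I_n -> 'I_p}| by apply/card_gt0P; exists [ffun=> Ordinal p0].
have [pi eturan] := @eq_bigmax {ffun 'I_n -> 'I_p} (fun pi => #|cross [set: 'I_n] pi|) p0'.
rewrite /turan {}eturan.
pose V i := [set x | pi x == i].
have [i0 Vi0] : exists i, #|cover H| <= #|V i|.
  apply/existsP; apply: contraT; rewrite negb_exists => /forallP lt.
  have : \sum_(i : 'I_p) #|V i| < #|cover H| * p.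
    rewrite mulnC -[X in X * _]card_ord -sum_nat_const.
    apply: (@leq_ltn_trans (\sum_(i : 'I_p) (#|cover H|).-1)).
      by apply: leq_sum => i _; have := lt i; rewrite -ltnNge; lia.
    rewrite !sum_nat_const card_ord ltn_pmul2l // prednK //.
    by have := lt (Ordinal p0); rewrite -ltnNge; lia.
  have -> : \sum_(i : 'I_p) #|V i| = n.
    rewrite -[RHS](card_ord n) -sum1_card (partition_big pi xpredT) //=.
    apply: eq_bigr => i _; rewrite -sum1_card; apply: eq_bigl => x.
    by rewrite inE.
  by rewrite ltnNge small.
have [h h_inj hV] := @inj_in_exists _ _ (cover H) (V i0) (Ordinal n0) Vi0.
have hcov e x : e \in H -> x \in e -> x \in cover H by move=> eH xe; apply/coverP; exists e.
pose HE := [set h @: e | e : {set T} in H].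
have HE_card : #|HE| = #|H|.
  apply: card_in_imset => e f eH fH ef; apply/setP=> x.
  wlog suff : e f eH fH ef / x \in e -> x \in f.
    by move=> w; apply/idP/idP; apply: w.
  move=> xe; have : h x \in h @: f by rewrite -ef imset_f.
  case/imsetP=> y yf hxy; rewrite (h_inj x y _ _ hxy) //.
  - exact: hcov eH xe.
  - exact: hcov fH yf.
have HE_complete : HE \subset complete 'I_n.
  apply/subsetP=> _ /imsetP[e eH ->]; rewrite inE card_in_imset.
    by move: (subsetP sH _ eH); rewrite inE.
  by move=> x y xe ye; apply: h_inj; apply: hcov eH _.
have HE_mono e : e \in HE -> mono pi e.
  case/imsetP=> f fH ->; apply/forall_inP=> _ /imsetP[x xf ->].
  apply/forall_inP=> _ /imsetP[y yf ->].
  have := hV _ (hcov _ _ fH xf); have := hV _ (hcov _ _ fH yf).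
  by rewrite !inE => /eqP-> /eqP->.
pose E := HE :|: cross [set: 'I_n] pi.
have cE : #|E| = #|H| + #|cross [set: 'I_n] pi|.
  rewrite cardsU HE_card [_ :&: _](_ : _ = set0) ?cards0 ?subn0 //.
  apply/setP=> e; rewrite !inE; apply/negP=> /andP[/HE_mono me].
  by rewrite me andbF andbF.
have sE : E \subset complete 'I_n.
  by rewrite subUset HE_complete; apply/subsetP=> e; rewrite inE => /andP[].
rewrite -cE /ex; apply: (bigmax_sup E) => //.
rewrite /simple_graph sE /=; apply/negP=> /contains_fanP[v [C [cC vC clC dC]]].
have Emono x y : [set x; y] \in E -> pi x = pi y ->
    exists a b, [/\ [set a; b] \in H, x = h a & y = h b].
  move=> xyE pxy; move: (xyE); rewrite in_setU inE mono_pair pxy eqxx !andbF orbF.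
  case/imsetP=> e eH xy_e.
  have /imsetP[a ae xa] : x \in h @: e by rewrite -xy_e set21.
  have /imsetP[b be yb] : y \in h @: e by rewrite -xy_e set22.
  exists a, b; split=> //; have [c _ eE] := edge_otherP (subsetP sH _ eH) ae.
  move: be; rewrite eE => /set2P[ba|->]; last by rewrite -eE.
  by move: (subsetP sE _ xyE); rewrite set2_complete xa yb ba eqxx.
have clE i x y : x \in v |: C i -> y \in v |: C i -> x != y -> [set x; y] \in E.
  by have /cliqueP := clC i; apply.
have pair i : exists x y, [/\ x \in v |: C i, y \in v |: C i, x != y & pi x = pi y].
  have : ~~ [forall x in v |: C i, forall y in v |: C i, (pi x == pi y) ==> (x == y)].
    apply/negP=> /forall_inP inj_pi.
    have : #|pi @: (v |: C i)| = #|v |: C i|.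
      apply: card_in_imset => x y xC yC pxy; apply/eqP.
      by have /forall_inP/(_ y yC)/implyP := inj_pi x xC; apply; apply/eqP.
    rewrite cardsU1 vC cC /= => cpi.
    by have := max_card (mem (pi @: (v |: C i))); rewrite cpi card_ord ltnn.
  rewrite negb_forall_in => /exists_inP[x xC]; rewrite negb_forall_in => /exists_inP[y yC].
  by rewrite negb_imply => /andP[/eqP pxy xy]; exists x, y.
case: (eqVneq (pi v) i0) => [pv|pv].
  have nb i : exists a b, [/\ [set a; b] \in H, v = h a & h b \in C i].
    have [x [y [xC yC xy pxy]]] := pair i.
    suff [y' [y'C py']] : exists y', y' \in C i /\ pi v = pi y'.
      have [|a [b [abH va y'b]]] := Emono v y' _ py'.
        apply: (clE i); rewrite ?setU11 ?in_setU1 ?y'C ?orbT //.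
        by apply: contraTneq y'C => <-.
      by exists a, b; rewrite -y'b.
    case/setU1P: xC => [xv|xC]; case/setU1P: yC => [yv|yC].
    - by rewrite xv yv eqxx in xy.
    - by exists y; rewrite -xv.
    - by exists x; rewrite -yv.
    have [|a [b [abH xa yb]]] := Emono x y _ pxy.
      by apply: (clE i) => //; apply/setU1P; right.
    exists x; split=> //; rewrite pv xa.
    by have := hV a; rewrite inE => /(_ (hcov _ _ abH (set21 _ _)))/eqP.
  have [a [b0 [ab0H va _]]] := nb (Ordinal k0).
  have nb' i : exists b, ([set a; b] \in H) && (h b \in C i).
    have [a' [b [abH va' hbC]]] := nb i; exists b; rewrite hbC andbT.
    have -> // : a = a'.
    by apply: h_inj; rewrite -?va //; [apply: hcov ab0H _ | apply: hcov abH _]; rewrite set21.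
  pose w i := xchoose (nb' i).
  have wP i : ([set a; w i] \in H) /\ (h (w i) \in C i) by apply/andP/(xchooseP (nb' i)).
  have := dH a; rewrite nbr_star // ltnNge => /negP; apply.
  rewrite -[X in X <= _](card_ord k) -(@card_imset _ _ w).
    by apply: subset_leq_card; apply/subsetP=> _ /imsetP[i _ ->]; rewrite inE; case: (wP i).
  move=> i j wij; apply/eqP; apply: contraT => /dC /pred0P/(_ (h (w i))) /=.
  by have [_ ->] := wP i; rewrite wij; have [_ ->] := wP j.
have nb i : exists e, (e \in H) && (h @: e \subset C i).
  have [x [y [xC yC xy pxy]]] := pair i.
  have [|a [b [abH xa yb]]] := Emono x y _ pxy; first exact: (clE i).
  have pxi : pi x = i0.
    by rewrite xa; have := hV a; rewrite inE => /(_ (hcov _ _ abH (set21 _ _)))/eqP.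
  exists [set a; b]; rewrite abH imsetU1 imset_set1 subUset !sub1set -xa -yb.
  case/setU1P: xC => [xv|->]; first by rewrite -xv pxi eqxx in pv.
  by case/setU1P: yC => [yv|->] //; rewrite -yv -pxy pxi eqxx in pv.
pose w i := xchoose (nb i).
have wP i : (w i \in H) /\ (h @: w i \subset C i) by apply/andP/(xchooseP (nb i)).
have w_dis i j : i != j -> [disjoint w i & w j].
  move=> ij; apply/pred0P=> x /=; apply/negP=> /andP[xi xj].
  have [_ /subsetP si] := wP i; have [_ /subsetP sj] := wP j.
  have /pred0P/(_ (h x)) /= := dC _ _ ij.
  by rewrite si ?sj ?imset_f.
have w_inj : injective w.
  move=> i j wij; apply/eqP; apply: contraT => /w_dis.
  have [/(subsetP sH) wH _] := wP i; rewrite wij -setI_eq0 setIid -cards_eq0.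
  by move: wH; rewrite wij inE => /eqP->.
have mw : matching H [set w i | i in 'I_k].
  apply/andP; split; first by apply/subsetP=> _ /imsetP[i _ ->]; case: (wP i).
  apply/trivIsetP=> _ _ /imsetP[i _ ->] /imsetP[j _ ->] wij.
  by apply: w_dis; apply: contraNneq wij => ->.
by have := leq_matching_number mw; rewrite card_imset // card_ord leqNgt nuH.
Qed.

(** g bounds the number of edges of every graph whose maximum degree and
    matching number are at most K.  The exact maximum is given by a theorem of
    Chvatal and Hanson; the arguments below work for any such g. *)
Definition sparse_bound K g := forall (T : finType) (H : {set {set T}}),
  H \subset complete T -> (forall v, #|star H v| <= K) -> matching_number H <= K -> #|H| <= g.

Lemma add_star (T : finType) (H : {set {set T}}) K :
  H \subset complete T -> (forall v, #|star H v| <= K) ->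
  exists (U : finType) (H' : {set {set U}}),
    [/\ H' \subset complete U, forall v, #|star H' v| <= K,
        matching_number H' <= (matching_number H).+1 & #|H'| = #|H| + K].
Proof.
move=> sH dH; pose U := (T + option 'I_K)%type.
pose il (e : {set T}) : {set U} := inl @: e.
have il_inj : injective il by apply: imset_inj; move=> x y [].
pose A : {set {set U}} := il @: H.
pose st (j : 'I_K) : {set U} := [set inr None; inr (Some j)].
have st_inj : injective st.
  move=> i j /setP/(_ (inr (Some i))); rewrite !inE /= eqxx => /esym/eqP[].
  by [].
pose S : {set {set U}} := [set st j | j in 'I_K].
have cA : #|A| = #|H| by apply: card_imset.
have cS : #|S| = K by rewrite card_imset ?card_ord.
have AS : A :&: S = set0.
  apply/setP=> e; rewrite !inE; apply/negP=> /andP[/imsetP[f _ ->] /imsetP[j _]].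
  move/setP/(_ (inr None)); rewrite !inE eqxx /= => /imsetP[x _]; by [].
have inr_A e z : e \in A -> inr z \notin e.
  by case/imsetP=> f _ ->; apply/imsetP=> -[].
exists U, (A :|: S); split.
- rewrite subUset; apply/andP; split; apply/subsetP=> _ /imsetP[x xH ->].
    by rewrite inE card_imset; [move: (subsetP sH _ xH); rewrite inE | move=> ? ? []].
  by rewrite set2_complete.
- case=> [x|z].
    apply: leq_trans (dH x); rewrite -(card_imset _ il_inj).
    apply: subset_leq_card; apply/subsetP=> e; rewrite inE => /andP[/setUP[]].
      case/imsetP=> f fH -> xf; apply: imset_f; rewrite inE fH.
      by case/imsetP: xf => y yf [->].
    by case/imsetP=> j _ ->; rewrite !inE.
  rewrite -[X in _ <= X]cS; apply: subset_leq_card; apply/subsetP=> e.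
  by rewrite inE => /andP[/setUP[/(inr_A _ z)/negP|//]].
- have [M /andP[sM /trivIsetP tM] <-] := matching_number_witness (A :|: S).
  have -> : M = (M :&: A) :|: (M :&: S) by rewrite -setIUr; apply/esym/setIidPl.
  rewrite cardsU setIACA AS setI0 cards0 subn0 -addn1; apply: leq_add.
    pose N := [set e in H | il e \in M].
    have -> : M :&: A = il @: N.
      apply/setP=> e; apply/setIP/imsetP => [[eM /imsetP[f fH ef]]|[f]].
        by exists f; rewrite // inE fH -ef.
      by rewrite inE => /andP[fH fM] ->; split=> //; apply: imset_f.
    rewrite card_imset //; apply: leq_matching_number; apply/andP; split.
      by apply/subsetP=> e; rewrite inE => /andP[].
    apply/trivIsetP=> e f; rewrite !inE => /andP[eH eM] /andP[fH fM] ef.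
    have /tM/(_ fM) := eM; rewrite (inj_eq il_inj) => /(_ ef)/pred0P dis.
    apply/pred0P=> x /=; apply/negP=> /andP[xe xf].
    by have := dis (inl x); rewrite /= !imset_f.
  rewrite leqNgt; apply/negP=> /card_gt1P[e [f []]] /setIP[eM eS] /setIP[fM fS] ef.
  have /pred0P/(_ (inr None)) := tM _ _ eM fM ef.
  case/imsetP: eS => i _ ->; case/imsetP: fS => j _ ->.
  by rewrite /= !inE eqxx.
by rewrite cardsU AS cards0 subn0 cA cS.
Qed.

(** Disjoint stars with K edges can be added until the matching number is K.
    In particular g >= K ^ 2. *)
Lemma sparse_bound_stars K g (T : finType) (H : {set {set T}}) :
  sparse_bound K g -> H \subset complete T -> (forall v, #|star H v| <= K) ->
  matching_number H <= K -> #|H| + K * (K - matching_number H) <= g.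
Proof.
move=> gP sH dH nH; move: nH (leqnn (matching_number H)); move: {-2}(matching_number H) => a aK nHa.
have [l] := ubnP (K - a); elim: l T H a sH dH aK nHa => // l IHl T H a sH dH aK nHa lt.
have [eqK|neK] := eqVneq a K.
  by rewrite eqK subnn muln0 addn0; apply: gP; rewrite // -eqK.
have [U [H' [sH' dH' nH' cH']]] := add_star sH dH.
have {}lt : K - a.+1 < l by lia.
have aK' : a.+1 <= K by lia.
have := IHl U H' a.+1 sH' dH' aK' (leq_trans nH' _) lt; rewrite cH' ltnS => /(_ nHa).
nia.
Qed.

Lemma sparse_size (T : finType) (H : {set {set T}}) K :
  H \subset complete T -> (forall v, #|star H v| <= K) -> matching_number H <= K ->
  #|cover H| <= 4 * K ^ 2.
Proof.
move=> sH dH nH.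
have dH0 v : #|star H v| + 0 <= K + 0 by rewrite !addn0.
have := edges_le_cover (m := fun=> 0) sH dH0.
rewrite sum_nat_const !muln0 !addn0 => le1.
have le2 := card_cover_le sH.
nia.
Qed.

(** A sparse graph touches at most 4 K ^ 2 vertices, so it fits into one class
    of the Turan graph. *)
Lemma ex_sparse_bound n k p :
  0 < k -> 0 < p -> 4 * k ^ 2 * p <= n ->
  sparse_bound k.-1 (ex n (fan k p.+1) - turan p [set: 'I_n]).
Proof.
move=> k0 p0 nk T H sH dH nH.
have := @sparse_ex T H n k p k0 p0 sH.
have lt a : a <= k.-1 -> a < k by lia.
move=> /(_ (fun v => lt _ (dH v)) (lt _ nH)) le.
have := sparse_size sH dH nH => cH.
have : #|cover H| * p <= n by apply: leq_trans nk; rewrite leq_mul2r; apply/orP; right; nia.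
by move/le; lia.
Qed.

Lemma turan_le_ex n k p :
  0 < k -> 0 < p -> turan p [set: 'I_n] <= ex n (fan k p.+1).
Proof.
move=> k0 p0.
have := @sparse_ex 'I_0 set0 n k p k0 p0 (sub0set _).
have s0 (v : 'I_0) : #|star set0 v| < k by case: v.
have nu0 : matching_number (@set0 {set 'I_0}) < k.
  have [M /andP[]] := matching_number_witness (@set0 {set 'I_0}).
  by rewrite subset0 => /eqP-> _ <-; rewrite cards0.
have c0 : #|cover (@set0 {set 'I_0})| * p <= n.
  by rewrite /cover big_set0 cards0.
by move=> /(_ s0 nu0 c0); rewrite cards0 add0n.
Qed.

(** * Edges inside the classes of a nearly multipartite graph *)
Section TwoParts.
Variables (T : finType) (K g M : nat).
Hypothesis gP : sparse_bound K g.
Implicit Types (H : {set {set T}}) (m : T -> nat).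

(** Let b be the matching number of H2.  Removing H1, restoring the missing edges
    and adding K - b disjoint stars with K edges to H2 gains strictly. *)
Lemma two_parts_bound_extreme H1 H2 m :
  H1 \subset complete T -> H2 \subset complete T ->
  (forall v, #|star H2 v| <= K) ->
  0 < matching_number H1 <= K -> 0 < matching_number H2 <= K ->
  (forall v, #|star H1 v| + matching_number H2 <= K + m v) -> \sum_v m v <= M ->
  (matching_number H1 == 1) || (matching_number H2 == K) ->
  #|H1| + #|H2| < g + M.
Proof.
move=> s1 s2 d2 /andP[a0 aK] /andP[b0 bK] dm sm small.
have le1 := edges_le_cover s1 dm.
have le2 := sparse_bound_stars gP s2 d2 bK.
move: le1 sm; set S := \sum_v m v => le1 sm.
case/orP: small => /eqP e1; last by rewrite e1 in le1 le2; nia.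
have [e2|ne2] := eqVneq (matching_number H2) K; first by rewrite e2 in le1 le2; nia.
have [c cE] : exists c, K = matching_number H2 + c.+1.
  by exists (K - (matching_number H2).+1); lia.
rewrite e1 in le1.
have : K * (K - matching_number H2) >= 2 * c.+1 by rewrite {2}cE addKn; nia.
by move: le1 le2 sm; rewrite {1 2}cE; nia.
Qed.

(** H1 and H2 will be the edges inside one class and inside the other classes;
    m1 and m2 count missing edges between the classes, at most M in total.
    With matching numbers a and b, both at least 2 and less than K, the bounds
    of [edges_le_gallai] add up to
    K (a + b) - a b + M = K ^ 2 - (K - a) (K - b) + M < g + M. *)
Lemma two_parts_bound H1 H2 m1 m2 :
  H1 \subset complete T -> H2 \subset complete T ->
  (forall v, #|star H1 v| <= K) -> (forall v, #|star H2 v| <= K) ->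
  0 < matching_number H1 <= K -> 0 < matching_number H2 <= K ->
  (forall v, #|star H1 v| + matching_number H2 <= K + m1 v) -> \sum_v m1 v <= M ->
  (forall v, #|star H2 v| + matching_number H1 <= K + m2 v) -> \sum_v m2 v <= M ->
  #|H1| + #|H2| < g + M.
Proof.
move=> s1 s2 d1 d2 a1 a2 dm1 sm1 dm2 sm2.
case sm12 : ((matching_number H1 == 1) || (matching_number H2 == K)).
  exact: two_parts_bound_extreme dm1 sm1 sm12.
case sm21 : ((matching_number H2 == 1) || (matching_number H1 == K)).
  by rewrite addnC; apply: two_parts_bound_extreme dm2 sm2 sm21.
move: sm12 sm21 => /norP[a_1 b_K] /norP[b_1 a_K].
case/andP: a1 => a0 aK; case/andP: a2 => b0 bK.
have := edges_le_gallai s1 _ d1 dm1; have := edges_le_gallai s2 _ d2 dm2.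
have /andP[] : (2 <= matching_number H1 <= K) && (2 <= matching_number H2 <= K) by lia.
move=> -> -> /(_ isT) le2 /(_ isT) le1.
have gK : K * K <= g.
  have s0 : @set0 {set T} \subset complete T by apply: sub0set.
  have d0 (v : T) : #|star set0 v| <= K.
    by rewrite (_ : star set0 v = set0) ?cards0 //; apply/setP=> e; rewrite !inE.
  have n0 : matching_number (@set0 {set T}) = 0.
    have [N /andP[]] := matching_number_witness (@set0 {set T}).
    by rewrite subset0 => /eqP-> _ <-; rewrite cards0.
  by have := sparse_bound_stars gP s0 d0; rewrite n0 cards0 subn0; apply.
move: le1 le2 sm1 sm2; set S1 := \sum_v m1 v; set S2 := \sum_v m2 v => le1 le2 sm1 sm2.
have [c cE] : exists c, K = matching_number H1 + c.+1 by exists (K - (matching_number H1).+1); lia.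
have [d dE] : exists d, K = matching_number H2 + d.+1 by exists (K - (matching_number H2).+1); lia.
have mulE : K * K + matching_number H1 * matching_number H2 =
    K * (matching_number H1 + matching_number H2) + c.+1 * d.+1.
  move: (matching_number H1) (matching_number H2) cE dE => a b Ka Kb.
  have -> : K * K = (a + c.+1) * (b + d.+1) by rewrite -Ka -Kb.
  have -> : K * (a + b) = (b + d.+1) * a + (a + c.+1) * b by rewrite -Ka -Kb mulnDr.
  by ring.
have cd : 0 < c.+1 * d.+1 by rewrite muln_gt0.
move: (c.+1 * d.+1) mulE cd => q mulE cd.
clear -le1 le2 sm1 sm2 gK mulE cd.
move: (matching_number H1) (matching_number H2) le1 le2 mulE => a b le1 le2 mulE.
arith_generalize; lia.
Qed.

End TwoParts.

Lemma card_meets (T : finType) (N : {set {set T}}) (D : {set T}) :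
  trivIset N -> #|N :\: [set e : {set T} | [disjoint e & D]]| <= #|D|.
Proof.
move=> /trivIsetP tN; have [-> | [x0 x0D]] := set_0Vmem D.
  rewrite (_ : _ :\: _ = set0) ?cards0 //; apply/setP=> e; rewrite !inE.
  by rewrite -setI_eq0 setI0 eqxx.
pose f (e : {set T}) := odflt x0 [pick x in e :&: D].
have fP e : e \in N :\: [set e : {set T} | [disjoint e & D]] -> [/\ e \in N, f e \in e & f e \in D].
  rewrite !inE -setI_eq0 => /andP[/set0Pn[x xeD] eN]; rewrite /f.
  case: pickP => [y|/(_ x)]; last by rewrite xeD.
  by rewrite inE => /andP[].
rewrite -(@card_in_imset _ _ f).
  by apply: subset_leq_card; apply/subsetP=> _ /imsetP[e /fP[_ _ fD] ->].
move=> e e' /fP[eN fe _] /fP[eN' fe' _] ff; apply/eqP; apply: contraT => ee'.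
by have /pred0P/(_ (f e)) /= := tN _ _ eN eN' ee'; rewrite fe ff fe'.
Qed.

Lemma matching_number_avoid (T : finType) (H : {set {set T}}) (D : {set T}) :
  matching_number H <= matching_number [set e in H | [disjoint e & D]] + #|D|.
Proof.
have [N mN <-] := matching_number_witness H; have /andP[/subsetP sN tN] := mN.
rewrite -(cardsID [set e : {set T} | [disjoint e & D]] N); apply: leq_add.
  apply: leq_matching_number; apply/andP; split.
    by apply/subsetP=> e; rewrite !inE => /andP[/sN-> ->].
  by apply: trivIsetS tN; apply: subsetIl.
exact: card_meets.
Qed.

Section Partitioned.
Variables (T I : finType) (pi : T -> I).
Implicit Types (e f : {set T}) (G H : {set {set T}}) (u v w x y : T).

Definition inner G := [set e in G | mono pi e].
Definition missing G := [set e in complete T | ~~ mono pi e & e \notin G].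
(** The edges inside the other classes that form a triangle with v: these and
    the edges of the star of v inside its own class are the ones that can be
    completed to cliques through v. *)
Definition seen G v :=
  [set e in inner G | [forall x in e, (pi x != pi v) && ([set v; x] \in G)]].
(** The number of cliques that can be packed around v when every class is large,
    see [has_fan_fan_number]. *)
Definition fan_number G v := #|star (inner G) v| + matching_number (seen G v).
(** x behaves as in the complete multipartite graph with the same classes. *)
Definition clean G x := [forall y, (x != y) ==> (([set x; y] \in G) == (pi x != pi y))].

Lemma innerP G e : e \in inner G -> [/\ e \in G & {in e &, forall x y, pi x = pi y}].
Proof.
rewrite inE => /andP[eG /forall_inP me]; split=> // x y xe ye; apply/eqP.
by have /forall_inP := me x xe; apply.
Qed.

Lemma inner_complete G : G \subset complete T -> inner G \subset complete T.
Proof. by apply: subset_trans; apply/subsetP=> e; rewrite inE => /andP[]. Qed.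

Lemma seen_inner G v : seen G v \subset inner G.
Proof. by apply/subsetP=> e; rewrite inE => /andP[]. Qed.

Lemma clean_adj G x y : clean G x -> pi x != pi y -> [set x; y] \in G.
Proof.
move=> /forallP/(_ y)/implyP cx pxy; rewrite (eqP (cx _)) //.
by apply: contraNneq pxy => ->.
Qed.

Lemma clean_inner G x e :
  G \subset complete T -> clean G x -> e \in inner G -> x \notin e.
Proof.
move=> sG /forallP cx /innerP[eG eM]; apply/negP=> xe.
have [y xy eE] := edge_otherP (subsetP sG _ eG) xe.
have := cx y; rewrite xy -eE eG (eM x y) ?eqxx //.
by rewrite eE set22.
Qed.

Lemma clean_seen G x e :
  clean G x -> e \in inner G -> (forall y, y \in e -> pi y != pi x) -> e \in seen G x.
Proof.
move=> cx eI ne; rewrite inE eI; apply/forall_inP=> y ye; rewrite (ne y ye) /=.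
by apply: clean_adj => //; rewrite eq_sym ne.
Qed.

(** If no vertex is the centre of a fan with K + 1 cliques, then the number of
    inner edges exceeds the number of missing edges by at most g.  Moreover the
    excess is smaller than g as soon as two classes contain inner edges; this
    strict form is what the argument with colours needs.  A missing edge raises
    the degree bound at both its ends, so the inner edges H1 of one class are
    compared with all the other inner edges H2, and each of the two bounds is
    charged only once for each missing edge. *)
Lemma inner_edges_bound G K g :
  G \subset complete T -> 1 < #|I| -> sparse_bound K g ->
  (forall i, exists2 x, clean G x & pi x = i) ->
  (forall v, fan_number G v <= K) ->
  (#|inner G| <= g /\ exists i, {in inner G, forall e, {in e, forall x, pi x = i}})
  \/ #|inner G| < g + #|missing G|.
Proof.
move=> sG I2 gP cl vK; have sI := inner_complete sG.
have other i : exists j : I, j != i.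
  by have/card_gt1P[j [j' [_ _ jj']]] := I2; have [<-|ji] := eqVneq j i;
    [exists j'; rewrite eq_sym | exists j].
have dK v : #|star (inner G) v| <= K by apply: leq_trans (vK v); apply: leq_addr.
case: (boolP [exists i, [forall e in inner G, [forall x in e, pi x == i]]]).
  case/existsP=> i /forall_inP hi; left.
  have hi' e x : e \in inner G -> x \in e -> pi x = i.
    by move=> eI xe; apply/eqP; have /forall_inP := hi e eI; apply.
  split; last by exists i => e eI x xe; apply: hi' eI xe.
  apply: gP => //; have [j ji] := other i; have [z cz pz] := cl j.
  apply: leq_trans (vK z); apply: leq_trans (leq_addl _ _); apply: matching_number_mono.
  apply/subsetP=> e eI; apply: clean_seen => // y ye.
  by rewrite (hi' e y) // pz eq_sym.
rewrite negb_exists => /forallP ne; right.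
have [j0 _] : exists j0 : I, j0 \in I by apply/card_gt0P; apply: ltnW.
have := ne j0; rewrite negb_forall_in => /exists_inP[e0 e0I].
rewrite negb_forall_in => /exists_inP[x0 x0e _].
pose i := pi x0.
pose H1 := [set e in inner G | [forall x in e, pi x == i]].
pose H2 := inner G :\: H1.
have s1 : H1 \subset inner G by apply/subsetP=> e; rewrite inE => /andP[].
have s2 : H2 \subset inner G by apply: subsetDl.
have p1 e x : e \in H1 -> x \in e -> pi x = i.
  by rewrite inE => /andP[_ /forall_inP h] xe; apply/eqP/h.
have p2 e x : e \in H2 -> x \in e -> pi x != i.
  rewrite !inE => /andP[nH eI] xe; apply: contra nH => /eqP px.
  rewrite -[e \in G]andbT; move: eI => /andP[eG me]; rewrite eG me /=.
  apply/forall_inP=> y ye; have /innerP[_ h] : e \in inner G by rewrite inE eG.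
  by rewrite (h y x) // px.
have cI : #|inner G| = #|H1| + #|H2|.
  by rewrite -(cardsID H1 (inner G)) (setIidPr s1).
have nu_gt0 H : H \subset complete T -> H != set0 -> 0 < matching_number H.
  move=> sH /set0Pn[e eH]; have [N mN cN] := matching_number_witness H.
  have [x _ /coverP[f fN _]] := maximum_meets sH mN cN eH.
  by rewrite -cN; apply/card_gt0P; exists f.
have [z1 cz1 pz1] := cl i; have [j ji] := other i; have [z2 cz2 pz2] := cl j.
have b1 : 0 < matching_number H1 <= K.
  apply/andP; split.
    apply: nu_gt0; first exact: subset_trans s1 sI.
    apply/set0Pn; exists e0; rewrite inE e0I /=; apply/forall_inP=> y ye.
    by have [_ h] := innerP e0I; rewrite (h y x0).
  apply: leq_trans (vK z2); apply: leq_trans (leq_addl _ _); apply: matching_number_mono.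
  apply/subsetP=> e eH; apply: clean_seen => // [|y ye]; first exact: (subsetP s1).
  by rewrite (p1 e y) // pz2 eq_sym.
have b2 : 0 < matching_number H2 <= K.
  apply/andP; split.
    apply: nu_gt0; first exact: subset_trans s2 sI.
    have := ne i; rewrite negb_forall_in => /exists_inP[e eI].
    by move=> nH; apply/set0Pn; exists e; rewrite inE eI andbT inE eI.
  apply: leq_trans (vK z1); apply: leq_trans (leq_addl _ _); apply: matching_number_mono.
  apply/subsetP=> e eH; apply: clean_seen => // [|y ye]; first exact: (subsetP s2).
  by rewrite pz1 (p2 e y).
pose cond v u := [&& pi v == i, pi u != i & [set v; u] \notin G].
pose m1 v := \sum_u cond v u; pose m2 u := \sum_v cond v u.
have sumE : \sum_v m1 v <= #|missing G|.
  pose P := [set q : T * T | cond q.1 q.2].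
  have -> : \sum_v m1 v = #|P|.
    rewrite /m1 pair_bigA -sum1_card [RHS]big_mkcond /=.
    by apply: eq_bigr => q _; rewrite inE.
  have inj : {in P &, injective (fun q => [set q.1; q.2])}.
    move=> [a b] [a' b']; rewrite !inE /= => /and3P[/eqP pa pb _] /and3P[/eqP pa' pb' _] eq2.
    have aE : a = a'.
      have : a \in [set a'; b'] by rewrite -eq2 set21.
      by case/set2P=> // ab; rewrite -ab pa eqxx in pb'.
    have : b \in [set a'; b'] by rewrite -eq2 set22.
    by case/set2P=> [ba|->]; [rewrite ba pa' eqxx in pb | rewrite aE].
  rewrite -(card_in_imset inj); apply: subset_leq_card; apply/subsetP=> _ /imsetP[[a b] + ->].
  rewrite inE => /and3P[/= /eqP pa pb nG].
  rewrite inE set2_complete mono_pair nG pa [i == _]eq_sym pb !andbT.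
  by apply: contraNneq pb => <-; rewrite pa.
have sum2 : \sum_u m2 u <= #|missing G| by rewrite /m2 exchange_big.
rewrite cI; apply: (two_parts_bound gP _ _ _ _ b1 b2 _ sumE _ sum2).
- exact: subset_trans s1 sI.
- exact: subset_trans s2 sI.
- move=> v; apply: leq_trans (dK v); apply: subset_leq_card.
  by apply/subsetP=> e; rewrite !inE => /andP[/andP[-> _] ->].
- move=> v; apply: leq_trans (dK v); apply: subset_leq_card.
  by apply/subsetP=> e; rewrite !inE => /andP[/andP[_ ->] ->].
- move=> v; have [pv|pv] := eqVneq (pi v) i; last first.
    rewrite (_ : star H1 v = set0) ?cards0.
      by case/andP: b2 => _ b2; apply: leq_trans b2 (leq_addr _ _).
    apply/setP=> e; rewrite in_set0 inE; apply/negP=> /andP[eH ve].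
    by rewrite (p1 e v) ?eqxx in pv.
  apply: leq_trans (leq_add (vK v) (leqnn _)); rewrite /fan_number -addnA; apply: leq_add.
    apply: subset_leq_card; apply/subsetP=> e.
    by rewrite !inE => /andP[/andP[-> _] ->].
  have := matching_number_avoid H2 [set u | cond v u]; rewrite [#|[set u | _]|](_ : _ = m1 v).
    move/leq_trans; apply; rewrite leq_add2r; apply: matching_number_mono.
    apply/subsetP=> e; rewrite [e \in _]inE => /andP[eH dis].
    rewrite inE (subsetP s2 _ eH); apply/forall_inP=> x xe.
    rewrite pv (p2 e x) //=; apply: contraTT dis => nG; apply/pred0Pn; exists x.
    by rewrite /= xe inE /cond pv eqxx (p2 e x).
  by rewrite -sum1_card big_mkcond; apply: eq_bigr => u _; rewrite inE.
- move=> v; have [pv|pv] := eqVneq (pi v) i.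
    rewrite (_ : star H2 v = set0) ?cards0.
      by case/andP: b1 => _ b1; apply: leq_trans b1 (leq_addr _ _).
    apply/setP=> e; rewrite in_set0 inE; apply/negP=> /andP[eH ve].
    by have := p2 e v eH ve; rewrite pv eqxx.
  apply: leq_trans (leq_add (vK v) (leqnn _)); rewrite /fan_number -addnA; apply: leq_add.
    apply: subset_leq_card; apply/subsetP=> e.
    by rewrite !inE => /andP[/andP[_ ->] ->].
  have := matching_number_avoid H1 [set u | cond u v]; rewrite [#|[set u | _]|](_ : _ = m2 v).
    move/leq_trans; apply; rewrite leq_add2r; apply: matching_number_mono.
    apply/subsetP=> e; rewrite [e \in _]inE => /andP[eH dis].
    rewrite inE (subsetP s1 _ eH); apply/forall_inP=> x xe.
    rewrite (p1 e x) // eq_sym pv /=; apply: contraTT dis => nG; apply/pred0Pn; exists x.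
    by rewrite /= xe inE /cond (p1 e x) // eqxx pv setUC.
  by rewrite -sum1_card big_mkcond; apply: eq_bigr => u _; rewrite inE.
Qed.

(** Complete every edge of the star at v, and every edge of the matching together
    with v, to a clique by one clean vertex
    from each class that it does not meet, using fresh clean vertices for each
    edge. *)
Lemma has_fan_fan_number G k v :
  G \subset complete T ->
  (forall i, k < #|[set x | clean G x && (pi x == i)]|) ->
  k <= fan_number G v -> has_fan G k #|I|.
Proof.
move=> sG cl kv.
pose Q i := [set x | clean G x && (pi x == i)] :\ v.
have QP i : k <= #|Q i|.
  by have := cl i; rewrite (cardsD1 v); case: (v \in _) => /=; rewrite ?add0n // => /ltnW.
pose w i (s : 'I_k) := enum_val (widen_ord (QP i) s).
have wP i s : [/\ clean G (w i s), pi (w i s) = i & w i s != v].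
  have : w i s \in Q i by apply: enum_valP.
  by rewrite !inE => /and3P[-> -> /eqP->].
have w_inj i s t : w i s = w i t -> s = t.
  by move=> /enum_val_inj/(congr1 \val) /= /ord_inj.
have [N mN cN] := matching_number_witness (seen G v).
have sN : N \subset seen G v by case/andP: mN.
pose J := star (inner G) v :|: N.
have seenP e : e \in N -> e \in inner G /\ {in e, forall x, pi x != pi v /\ [set v; x] \in G}.
  move=> /(subsetP sN); rewrite inE => /andP[eI /forall_inP h]; split=> // x xe.
  by have /andP[] := h x xe.
have vN e : e \in N -> v \notin e.
  by move=> /seenP[_ h]; apply/negP=> /h[]; rewrite eqxx.
have cJ : k <= #|J|.
  rewrite cardsU cN [_ :&: _](_ : _ = set0) ?cards0 ?subn0 //.
  apply/setP=> e; rewrite in_set0 in_setI; apply/negP=> /andP[].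
  by rewrite inE => /andP[_ ve] /vN; rewrite ve.
pose E (s : 'I_k) := enum_val (widen_ord cJ s).
have EJ s : E s \in J by apply: enum_valP.
have E_inj : injective E by move=> s t /enum_val_inj/(congr1 \val) /= /ord_inj.
have JI e : e \in J -> e \in inner G.
  by case/setUP=> [|/seenP[]//]; rewrite inE => /andP[].
have Jin e : e \in J ->
    [/\ #|e :\ v| = #|pi @: (v |: e)|, {in e :\ v, forall u, [set v; u] \in G} &
        {in e :\ v &, forall x y, x != y -> [set x; y] \in G}].
  move=> eJ; have eI := JI e eJ; have [eG eM] := innerP eI.
  have ce : e \in complete T := subsetP sG _ eG.
  case: (boolP (v \in e)) => ve.
    have [u vu eE] := edge_otherP ce ve.
    have De : e :\ v = [set u].
      apply/setP=> x; rewrite eE !inE; have [->|] := eqVneq x v => //=.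
      by rewrite (negPf vu).
    rewrite De cards1; split.
    - apply/esym/eqP/cards1P; exists (pi v); apply/setP=> y; rewrite inE.
      apply/imsetP/eqP => [[x]|->]; last by exists v; rewrite ?setU11.
      by case/setU1P=> [->|xe] -> //; apply: eM.
    - by move=> x /set1P->; rewrite -eE.
    - by move=> x y /set1P-> /set1P->; rewrite eqxx.
  have eN : e \in N by case/setUP: eJ => //; rewrite inE (negPf ve) andbF.
  have [_ h] := seenP e eN.
  have De : e :\ v = e by apply/setDidPl; rewrite disjoint_sym disjoints1.
  have [x xe] : exists x, x \in e by apply/card_gt0P; move: ce; rewrite inE => /eqP->.
  have [y xy eE] := edge_otherP ce xe.
  rewrite De; split.
  - have -> : pi @: (v |: e) = [set pi v; pi x].
      rewrite imsetU1; apply/setP=> z; rewrite !inE; congr (_ || _).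
      apply/imsetP/eqP => [[a ae ->]|->]; last by exists x.
      exact: eM.
    by rewrite cards2 eq_sym; have [-> _] := h x xe; move: ce; rewrite inE => /eqP->.
  - by move=> u /h[].
  - move=> a b ae be ab; have [c ac eE'] := edge_otherP ce ae.
    move: be; rewrite eE' => /set2P[ba|->]; last by rewrite -eE'.
    by rewrite ba eqxx in ab.
have Jdis e f : e \in J -> f \in J -> e != f -> [disjoint e :\ v & f :\ v].
  move=> eJ fJ ef; apply/pred0P=> x /=; apply/negP=> /andP[/setD1P[xv xe] /setD1P[_ xf]].
  have other h : h \in J -> x \in h -> v \in h -> h = [set v; x].
    move=> hJ xh vh; have [hG _] := innerP (JI h hJ).
    have [y vy hE] := edge_otherP (subsetP sG _ hG) vh.
    by move: xh; rewrite hE => /set2P[xv'|->] //; rewrite xv' eqxx in xv.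
  have nN h : h \in J -> v \notin h -> h \in N.
    by move=> + vh; case/setUP=> //; rewrite inE (negPf vh) andbF.
  have mix h h' : h \in J -> h' \in J -> x \in h -> x \in h' -> v \in h -> v \notin h' -> False.
    move=> hJ hJ' xh xh' vh vh'; have [_ /(_ x xh')[/negP]] := seenP _ (nN h' hJ' vh').
    by case; apply/eqP; have [_ hM] := innerP (JI h hJ); apply: hM.
  case: (boolP (v \in e)) => ve; case: (boolP (v \in f)) => vf.
  - by rewrite (other e) // (other f) // eqxx in ef.
  - exact: (mix e f).
  - exact: (mix f e).
  - case/andP: mN => _ /trivIsetP/(_ _ _ (nN e eJ ve) (nN f fJ vf) ef)/pred0P/(_ x) /=.
    by rewrite xe xf.
pose W s := [set w j s | j in ~: pi @: (v |: E s)].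
pose C s := (E s :\ v) :|: W s.
have EW s t : [disjoint E s :\ v & W t].
  apply/pred0P=> x /=; apply/negP=> /andP[/setD1P[_ xe] /imsetP[j _ xw]].
  have [cw _ _] := wP j t.
  by have /negP := clean_inner sG cw (JI _ (EJ s)); rewrite -xw xe.
exists v, C; split.
- move=> s; rewrite cardsU (disjoint_setI0 (EW s s)) cards0 subn0 card_imset; last first.
    by move=> j j' jj'; have [_ <- _] := wP j s; rewrite jj'; have [_ -> _] := wP j' s.
  by have [-> _ _] := Jin _ (EJ s); rewrite cardsC.
- move=> s; rewrite !inE eqxx /=; apply/imsetP=> -[j _ vw].
  by have [_ _] := wP j s; rewrite -vw eqxx.
- move=> s; have [cE vE eE] := Jin _ (EJ s).
  have wadj j x : j \notin pi @: (v |: E s) -> x \in v |: E s -> [set x; w j s] \in G.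
    move=> jn xe; have [cw pw _] := wP j s; rewrite setUC; apply: clean_adj => //.
    by rewrite pw; apply: contraNneq jn => ->; apply: imset_f.
  apply: clique_setU1; last first.
    move=> x /setUP[/vE//|/imsetP[j]]; rewrite inE => jn ->.
    by apply: wadj => //; apply: setU11.
  apply/cliqueP=> x y /setUP[xe|/imsetP[j jn ->]] /setUP[ye|/imsetP[j' jn' ->]] xy.
  - exact: eE.
  - rewrite inE in jn'; apply: wadj => //; case/setD1P: xe => _ xe.
    by rewrite in_setU1 xe orbT.
  - rewrite inE in jn; rewrite setUC; apply: wadj => //; case/setD1P: ye => _ ye.
    by rewrite in_setU1 ye orbT.
  - have [cw pw _] := wP j s; have [cw' pw' _] := wP j' s.
    by apply: clean_adj; rewrite // pw pw'; apply: contraNneq xy => ->.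
- move=> s t st; have Est : E s != E t by rewrite (inj_eq E_inj).
  apply/pred0P=> x /=; apply/negP=> /andP[/setUP[xs|xs] /setUP[xt|xt]].
  + by have /pred0P/(_ x) := Jdis _ _ (EJ s) (EJ t) Est; rewrite /= xs xt.
  + by have /pred0P/(_ x) := EW s t; rewrite /= xs xt.
  + by have /pred0P/(_ x) := EW t s; rewrite /= xs xt.
  + case/imsetP: xs => j _ xj; case/imsetP: xt => j' _ xj'.
    have jj' : j = j' by have [_ <- _] := wP j s; rewrite -xj xj'; have [_ -> _] := wP j' t.
    by move/eqP: st; apply; apply: (w_inj j); rewrite -xj xj' jj'.
Qed.

End Partitioned.

(** * A nearly multipartite structure *)
Lemma card_bigcup_le (T J : finType) (P : {set J}) (F : J -> {set T}) :
  #|\bigcup_(x in P) F x| <= \sum_(x in P) #|F x|.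
Proof.
apply: (big_ind2 (fun (A : {set T}) n => #|A| <= n)) => [|A a B b hA hB|//].
  by rewrite cards0.
exact: leq_trans (leq_card_setU _ _) (leq_add hA hB).
Qed.

Section Structure.
Variables (T : finType) (G : {set {set T}}) (k p q : nat).
Hypothesis sG : G \subset complete T.
Hypothesis p_gt1 : 1 < p.
Hypothesis fan_free : ~ has_fan G k.+1 p.
Hypothesis degG : forall v, #|~: nbr G v| <= q.+1.
Hypothesis q_lt : q * p < #|T|.
Hypothesis q_large : 2 * k * p + p <= q.
Implicit Types (C S X Y : {set T}) (u v w x y z : T).

Let nbr_irr x : x \notin nbr G x.
Proof. by rewrite inE; apply/negP=> /(subsetP sG); rewrite set2_complete eqxx. Qed.

(** The union of a maximal family of disjoint cliques in the neighbourhood of x. *)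
Lemma hitting_set x :
  exists2 S : {set T}, #|S| <= k * p &
    forall C : {set T}, #|C| = p -> x \notin C -> clique G (x |: C) -> ~~ [disjoint C & S].
Proof.
pose good C := [&& #|C| == p, x \notin C & clique G (x |: C)].
pose fam (F : {set {set T}}) := trivIset F && (F \subset [set C | good C]).
have fam0 : fam set0.
  by rewrite /fam sub0set andbT; apply/trivIsetP=> A B; rewrite inE.
have [F /andP[tF /subsetP gF] maxF] :
  exists2 F, fam F & forall F', fam F' -> #|F'| <= #|F|.
  by case: (arg_maxnP (fun F : {set {set T}} => #|F|) fam0) => F; exists F.
have goodF C : C \in F -> good C by move/gF; rewrite inE.
have cF : #|F| <= k.
  rewrite leqNgt; apply/negP=> kF; apply: fan_free.
  apply: (@has_fan_family _ _ F _ _ _ x id) => //.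
    by move=> C /goodF/and3P[/eqP-> -> ->].
  by apply/trivIsetP.
exists (cover F).
  apply: leq_trans (leq_card_cover F) _.
  apply: (@leq_trans (\sum_(C in F) p)); first by apply: leq_sum => C /goodF/and3P[/eqP->].
  by rewrite sum_nat_const leq_mul2r cF orbT.
move=> C cC xC clC; apply/negP=> dis.
have gC : good C by rewrite /good cC eqxx xC.
have F0 : set0 \notin F.
  by apply/negP=> /goodF/and3P[]; rewrite cards0 eq_sym => /eqP p0; move: p_gt1; rewrite p0.
have [] := @trivIsetU1 _ C F _ tF F0.
  move=> B BF; apply: disjointWr dis; exact: (bigcup_sup B).
move=> tCF CF; have := maxF (C |: F); rewrite cardsU1 CF ltnn => h.
suff : false by []; apply: h; rewrite /fam tCF; apply/subsetP=> B.
by rewrite !inE => /orP[/eqP->|/goodF].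
Qed.

Lemma clique_extend1 X S :
  clique G X -> #|X| < p -> #|S| <= 2 * k * p ->
  exists y, [/\ y \notin S, y \notin X & clique G (y |: X)].
Proof.
move=> clX cX cS; pose B := S :|: \bigcup_(x in X) ~: nbr G x.
have cB : #|B| < #|T|.
  apply: leq_ltn_trans q_lt; apply: leq_trans (leq_card_setU _ _) _.
  have : #|\bigcup_(x in X) ~: nbr G x| <= #|X| * q.+1.
    rewrite -sum_nat_const; apply: leq_trans (_ : \sum_(x in X) #|~: nbr G x| <= _).
      exact: card_bigcup_le.
    by apply: leq_sum => x _.
  have : #|X| * q.+1 <= p.-1 * q.+1 by rewrite leq_mul2r orbC -ltnS prednK ?cX // ltnW.
  move: cS q_large; case: p p_gt1 => // p' _ /= cS qL.
  by arith_generalize; nia.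
have /card_gt0P[y] : 0 < #|~: B| by have := cardsC B; move: cB; slia.
rewrite !inE negb_or => /andP[yS /bigcupP yX].
have adj x : x \in X -> [set y; x] \in G.
  move=> xX; apply: contraT => nyx; case: yX; exists x => //.
  by rewrite !inE setUC.
exists y; split=> //.
  by apply/negP=> /adj/(subsetP sG); rewrite set2_complete eqxx.
by apply: clique_setU1.
Qed.

Lemma clique_extend X S :
  clique G X -> #|X| <= p -> #|S| <= 2 * k * p ->
  exists Y : {set T}, [/\ clique G Y, #|Y| = p, X \subset Y & [disjoint Y :\: X & S]].
Proof.
move=> clX cX cS; have [l] := ubnP (p - #|X|); elim: l X clX cX => // l IHl X clX cX lt.
have [eXp|neXp] := eqVneq #|X| p.
  by exists X; split; rewrite // setDv -setI_eq0 set0I.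
have [|y [yS yX clyX]] := clique_extend1 clX _ cS; first by rewrite ltn_neqAle neXp.
have cyX : #|y |: X| = #|X|.+1 by rewrite cardsU1 yX.
have := IHl (y |: X) clyX; rewrite cyX => IH.
have [|| Y [clY cY sY dY]] := IH.
- by rewrite ltn_neqAle neXp.
- by move: lt neXp cX; slia.
exists Y; split=> //; first by apply: subset_trans sY; apply: subsetUr.
apply/pred0P=> z /=; apply/negP=> /andP[/setDP[zY zX] zS].
have [zy|zy] := eqVneq z y; first by rewrite -zy zS in yS.
have /pred0P/(_ z) := dY.
by rewrite /= inE in_setU1 (negPf zy) (negPf zX) zY zS.
Qed.

(** Zb bounds the number of exceptional vertices, Db the number of non-neighbours
    of an ordinary vertex outside its class, and D2 the number of neighbours of an
    exceptional vertex among the ordinary vertices of the class it is put in. *)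
Let Zb := 4 * k * p + p.
Let Db := 4 * k * p + 2 * p.
Let D2 := p.-1 * Db + k * p.

(** Take a clique Y on p vertices, two of which, x1 and x2, have hitting sets S1
    and S2 that Y avoids as far as possible.  Since the minimum degree is
    that of the Turan graph, all but a few vertices miss exactly one vertex x
    of Y; they form the set U x.  An edge inside U x together with Y minus x
    would give a clique in the neighbourhood of x1 or of x2 that avoids the
    hitting set, so the sets U x are independent outside S1 and S2, and by the
    degree condition nearly complete to each other.  An exceptional vertex with
    many neighbours in every U x would be the centre of a fan, so it has few
    neighbours in some U x and joins that class. *)
Lemma partition_exists :
  exists pi : T -> 'I_p,
    #|inner pi G| <= Zb * (D2 + Zb) /\
    forall i, q < #|[set x | pi x == i]| + Zb + p.
Proof.
have p0 : 0 < p by apply: ltnW.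
have [x1 _] : exists x1 : T, x1 \in T by apply/card_gt0P; apply: leq_ltn_trans q_lt.
have [S1 cS1 hS1] := hitting_set x1.
have cl1 : clique G [set x1].
  by apply/cliqueP=> a b /set1P-> /set1P->; rewrite eqxx.
have [||x2 [x2S1 x2x1 cl2]] := @clique_extend1 [set x1] S1 cl1.
- by rewrite cards1.
- by apply: leq_trans cS1 _; rewrite leq_mul2r; apply/orP; right; slia.
have [S2 cS2 hS2] := hitting_set x2.
have c12 : #|[set x2; x1]| = 2 by rewrite cardsU1 x2x1 cards1.
have [||Y [clY cY sY dY]] := @clique_extend [set x2; x1] (S1 :|: S2) cl2.
- by rewrite c12.
- apply: leq_trans (leq_card_setU _ _) _; move: (leq_add cS1 cS2).
  by rewrite -mulnA mul2n -addnn.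
have x1Y : x1 \in Y by apply: (subsetP sY); rewrite set22.
have x2Y : x2 \in Y by apply: (subsetP sY); rewrite set21.
have x12 : x1 != x2 by move: x2x1; rewrite inE eq_sym.
have Yout x : x \in Y -> x != x1 -> x != x2 -> x \notin S1 /\ x \notin S2.
  move=> xY n1 n2; have /pred0P/(_ x) := dY.
  rewrite /= !inE negb_or n1 n2 xY /=.
  by case: (x \in S1) => //= ->.
pose non y := Y :\: nbr G y.
have nonP x y : x \in Y -> x \notin non y -> [set y; x] \in G.
  by move=> xY; rewrite inE xY andbT negbK inE.
(* a vertex adjacent to all of Y would replace x1, giving a clique that
   avoids S1, unless it lies in S1 itself *)
pose B := [set y | non y == set0].
have sB : B \subset S1.
  apply/subsetP=> y; rewrite inE => /eqP ny.
  have adj x : x \in Y -> [set y; x] \in G by move=> xY; apply: nonP; rewrite // ny inE.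
  have yY : y \notin Y.
    apply/negP=> yY; have : y \in non y by rewrite inE yY nbr_irr.
    by rewrite ny inE.
  have yx1 : y != x1 by apply: contraNneq yY => ->.
  have CE : x1 |: (y |: Y :\ x1) = y |: Y.
    by rewrite setUCA setD1K.
  have := hS1 (y |: Y :\ x1); rewrite CE.
  have -> : #|y |: Y :\ x1| = p.
    by rewrite cardsU1 in_setD1 (negPf yY) andbF -cY (cardsD1 x1 Y) x1Y.
  have -> : x1 \notin y |: Y :\ x1 by rewrite !inE eqxx eq_sym (negPf yx1).
  move=> /(_ erefl isT (clique_setU1 clY adj)) /pred0Pn[z /andP[/setU1P[->//|/setD1P[zx1 zY]] zS]].
  have {}zS : z \in S1 := zS.
  have [zx2|zx2] := eqVneq z x2; first by rewrite zx2 in zS; rewrite zS in x2S1.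
  by have [] := Yout z zY zx1 zx2; rewrite zS.
(* the degree condition: a vertex misses one vertex of Y on average, up to an
   error of p in total *)
pose R := [set y | #|non y| != 1].
have cR : #|R| <= 2 * k * p + p.
  pose L := [set y | 1 < #|non y|].
  have sR : R \subset B :|: L.
    by apply/subsetP=> y; rewrite !inE -cards_eq0; case: #|non y| => [|[]].
  have cB : #|B| <= k * p by apply: leq_trans (subset_leq_card sB) cS1.
  have sumn : \sum_y #|non y| <= p * q.+1.
    have -> : \sum_y #|non y| = \sum_(x in Y) #|~: nbr G x|.
      under eq_bigr do rewrite -sum1_card big_mkcond /=.
      rewrite exchange_big /= [RHS]big_mkcond /=; apply: eq_bigr => x _.
      rewrite -sum1_card [in RHS]big_mkcond /=; case: ifP => xY.
        by apply: eq_bigr => y _; rewrite !inE xY andbT setUC.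
      by rewrite big1 // => y _; rewrite inE xY andbF.
    by rewrite -cY -sum_nat_const; apply: leq_sum => x _.
  have : #|T| + #|L| <= \sum_y #|non y| + #|B|.
    rewrite -!sum1_card (big_mkcond (mem L)) (big_mkcond (mem B)) /= -!big_split /=.
    apply: leq_sum => y _; rewrite !inE -cards_eq0.
    by case: #|non y| => [|[]].
  move=> le; have := leq_trans (subset_leq_card sR) (leq_card_setU B L).
  by move: le sumn cB q_lt; rewrite mulnS (mulnC p q) -mulnA; arith_generalize; lia.
pose Z := R :|: (S1 :|: S2).
have cZ : #|Z| <= Zb.
  apply: leq_trans (leq_card_setU _ _) _.
  have : #|S1 :|: S2| <= #|S1| + #|S2| by apply: leq_card_setU.
  move: cR cS1 cS2; rewrite /Zb.
  by arith_generalize; lia.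
pose U x := [set y | non y == [set x]] :\: Z.
have UP x y : y \in U x -> [/\ y \notin S1, y \notin S2 & non y = [set x]].
  by rewrite !inE !negb_or => /andP[/and3P[_ -> ->] /eqP->].
have U_uniq x x' y : y \in U x -> y \in U x' -> x = x'.
  by move=> /UP[_ _ e1] /UP[_ _]; rewrite e1 => /set1_inj.
have U_cover y : y \notin Z -> exists2 x, x \in Y & y \in U x.
  move=> yZ; have := yZ; rewrite !inE negb_or negbK => /andP[/cards1P[x nx] _].
  exists x; last by rewrite inE yZ inE nx eqxx.
  by have : x \in non y; [rewrite nx set11 | rewrite inE => /andP[]].
have U_ind x a b : x \in Y -> a \in U x -> b \in U x -> [set a; b] \notin G.
  move=> xY aU bU; apply/negP=> abG.
  have [aS1 aS2 na] := UP _ _ aU; have [bS1 bS2 nb] := UP _ _ bU.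
  have ab : a != b by move: (subsetP sG _ abG); rewrite set2_complete.
  have notY c d : [set c; d] \in G -> non c = [set x] -> non d = [set x] -> c \notin Y.
    move=> cdG nc nd; apply/negP=> cY'.
    have : c \in non c by rewrite inE cY' nbr_irr.
    rewrite nc inE => /eqP cx; have : x \in non d by rewrite nd set11.
    by rewrite inE inE -cx setUC cdG.
  have aY : a \notin Y := notY a b abG na nb.
  have bY : b \notin Y by apply: (notY b a); rewrite // setUC.
  have [c [S [hS cYc aS bS [cx SY]]]] : exists c (S : {set T}),
      [/\ forall C : {set T}, #|C| = p -> c \notin C -> clique G (c |: C) -> ~~ [disjoint C & S],
          c \in Y, a \notin S, b \notin S &
          c != x /\ {in Y, forall y, y != x -> y != c -> y \notin S}].
    have [xx1|xx1] := eqVneq x x1.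
      exists x2, S2; split=> //; split; first by rewrite xx1 eq_sym.
      by move=> y yY; rewrite xx1 => y1 y2; have [] := Yout y yY y1 y2.
    exists x1, S1; split=> //; split; first by rewrite eq_sym.
    move=> y yY _ y1; have [->//|y2] := eqVneq y x2.
    by have [] := Yout y yY y1 y2.
  pose C := a |: (b |: (Y :\ x :\ c)).
  have cC : c |: C = a |: (b |: Y :\ x).
    by rewrite /C setUCA (setUCA [set c]) setD1K // in_setD1 cx.
  have clC : clique G (c |: C).
    have adj y z : non y = [set x] -> z \in Y :\ x -> [set y; z] \in G.
      by move=> ny /setD1P[zx zY]; apply: nonP; rewrite // ny inE.
    rewrite cC; apply: clique_setU1.
      apply: clique_setU1; first by apply: cliqueS clY; apply: subsetDl.
      by move=> y; apply: adj.
    by move=> y /setU1P[->//|]; apply: adj.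
  have cardC : #|C| = p.
    rewrite !cardsU1 !inE (negPf aY) (negPf bY) !andbF (negPf ab) /= -cY.
    by rewrite (cardsD1 x Y) xY (cardsD1 c (Y :\ x)) in_setD1 cx cYc.
  have cnC : c \notin C.
    rewrite !inE eqxx /= orbF; apply/norP; split.
      by apply: contraNneq aY => <-.
    by apply: contraNneq bY => <-.
  have /pred0Pn[z /andP[zC zS]] := hS C cardC cnC clC.
  have {}zS : z \in S := zS.
  case/setU1P: zC => [za|/setU1P[zb|/setD1P[zc /setD1P[zx zY]]]].
  - by rewrite -za zS in aS.
  - by rewrite -zb zS in bS.
  - by have := SY z zY zx zc; rewrite zS.
have cU x : x \in Y -> #|U x| <= q.+1.
  move=> xY; have [->|[w wU]] := set_0Vmem (U x); first by rewrite cards0.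
  apply: leq_trans (degG w); apply: subset_leq_card; apply/subsetP=> y yU.
  by rewrite !inE; apply: (U_ind x).
have cT x : x \in Y -> #|T| <= Zb + #|U x| + p.-1 * q.+1.
  move=> xY; have cov : [set: T] \subset Z :|: \bigcup_(y in Y) U y.
    apply/subsetP=> y _; rewrite inE; case: (boolP (y \in Z)) => //= /U_cover[z zY yU].
    by apply/bigcupP; exists z.
  rewrite -cardsT; apply: leq_trans (subset_leq_card cov) _.
  apply: leq_trans (leq_card_setU _ _) _; rewrite -addnA; apply: leq_add => //.
  rewrite (big_setD1 x) //=; apply: leq_trans (leq_card_setU _ _) _.
  rewrite leq_add2l.
  have -> : p.-1 = #|Y :\ x| by rewrite -cY (cardsD1 x Y) xY.
  rewrite -sum_nat_const; apply: (@leq_trans (\sum_(y in Y :\ x) #|U y|)).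
    exact: card_bigcup_le.
  by apply: leq_sum => y /setD1P[_ yY]; apply: cU.
have pq : p * q.+1 = p.-1 * q.+1 + q.+1 by rewrite -{1}(prednK p0) mulSn addnC.
have missU x w : x \in Y -> w \in U x -> #|~: nbr G w :\: U x| <= Db.
  move=> xY wU; have sU : U x \subset ~: nbr G w.
    by apply/subsetP=> y yU; rewrite !inE; apply: (U_ind x).
  have := cardsD (~: nbr G w) (U x); rewrite (setIidPr sU) => ->.
  move: (cT x xY) (degG w) q_lt pq (cU x xY); rewrite /Zb /Db.
  move: (p.-1 * q.+1) => r; rewrite mulnS (mulnC p q).
  by arith_generalize; lia.
have place z : exists2 x, x \in Y & #|nbr G z :&: U x| <= D2.
  case: (boolP [exists x in Y, #|nbr G z :&: U x| <= D2]).
    by case/exists_inP=> x; exists x.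
  rewrite negb_exists_in => /forall_inP big.
  have [S cS hS] := hitting_set z.
  pose A x := (nbr G z :&: U x) :\: S.
  have cA x : x \in Y -> p.-1 * Db < #|A x|.
    move=> /big; rewrite -ltnNge /D2 => lt.
    have := cardsID S (nbr G z :&: U x); rewrite -/(A x).
    have := subset_leq_card (subsetIr (nbr G z :&: U x) S).
    by move: lt cS; move: (p.-1 * Db) => r; arith_generalize; lia.
  have build j : j <= p -> exists C Y0 : {set T},
      [/\ clique G C, #|C| = j, Y0 \subset Y, #|Y0| = j &
      {in C, forall c, exists2 x, x \in Y0 & c \in A x}].
    elim: j => [_|j IHj jp].
      exists set0, set0; rewrite cards0 sub0set; split=> //.
        by apply/cliqueP=> a b; rewrite inE.
      by move=> c; rewrite inE.
    have [C [Y0 [clC cC sY0 cY0 CA]]] := IHj (ltnW jp).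
    have [x xY xY0] : exists2 x, x \in Y & x \notin Y0.
      apply/subsetPn; apply/negP=> /subset_leq_card.
      by rewrite cY cY0 leqNgt jp.
    pose Bd := \bigcup_(c in C) (~: nbr G c :&: U x).
    have cBd : #|Bd| <= p.-1 * Db.
      have : #|Bd| <= \sum_(c in C) #|~: nbr G c :&: U x|.
        exact: card_bigcup_le.
      move/leq_trans; apply; apply: (@leq_trans (\sum_(c in C) Db)); last first.
        by rewrite sum_nat_const cC leq_mul2r; apply/orP; right; slia.
      apply: leq_sum => c cC'; have [x' x'Y0 cA'] := CA c cC'.
      have cU' : c \in U x' by move: cA'; rewrite !inE => /and3P[_ _].
      apply: leq_trans (missU x' c (subsetP sY0 _ x'Y0) cU').
      apply: subset_leq_card; apply/subsetP=> y /setIP[yn yU]; rewrite inE yn andbT.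
      by apply/negP=> yU'; move: xY0; rewrite (U_uniq _ _ _ yU yU') x'Y0.
    have /card_gt0P[y] : 0 < #|A x :\: Bd|.
      rewrite cardsD subn_gt0; apply: leq_ltn_trans (cA x xY).
      by apply: leq_trans cBd; apply: subset_leq_card; apply: subsetIr.
    case/setDP=> yA yB; have yU : y \in U x by move: yA; rewrite !inE => /and3P[_ _].
    have adj c : c \in C -> [set y; c] \in G.
      move=> cC'; apply: contraT => nyc; case/bigcupP: yB; exists c => //.
      by rewrite inE yU andbT !inE setUC.
    exists (y |: C), (x |: Y0); split.
    - exact: clique_setU1.
    - rewrite cardsU1 cC; suff -> : y \notin C by [].
      by apply/negP=> /adj/(subsetP sG); rewrite set2_complete eqxx.
    - by rewrite subUset sub1set xY.
    - by rewrite cardsU1 xY0 cY0.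
    - move=> c /setU1P[->|/CA[x' x'Y0 cA']]; first by exists x; rewrite // setU11.
      by exists x'; rewrite // in_setU1 x'Y0 orbT.
  have [C [Y0 [clC cC _ _ CA]]] := build p (leqnn p).
  have CP c : c \in C -> [set z; c] \in G /\ c \notin S.
    by move=> /CA[x _]; rewrite !inE => /and3P[-> -> _].
  have zC : z \notin C.
    by apply/negP=> /CP[/(subsetP sG)]; rewrite set2_complete eqxx.
  have /pred0Pn[c /andP[cC' cS']] : ~~ [disjoint C & S].
    by apply: hS => //; apply: clique_setU1 => // c /CP[].
  by have [_ /negP[]] := CP c cC'.
pose ok y x := (x \in Y) && (if y \in Z then #|nbr G y :&: U x| <= D2 else y \in U x).
pose rho y := odflt x1 [pick x | ok y x].
have rhoP y : ok y (rho y).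
  rewrite /rho; case: pickP => //= none.
  case: (boolP (y \in Z)) => [yZ|yZ].
    by have [x xY le] := place y; have := none x; rewrite /ok yZ xY le.
  by have [x xY yU] := U_cover y yZ; have := none x; rewrite /ok (negPf yZ) xY yU.
have rhoY y : rho y \in Y by case/andP: (rhoP y).
pose pi y := cast_ord cY (enum_rank_in x1Y (rho y)).
have pi_rho y z : pi y = pi z -> rho y = rho z.
  by move=> /cast_ord_inj; apply: enum_rank_in_inj.
exists pi; split.
  have sI := inner_complete pi sG.
  have le1 : #|inner pi G| <= \sum_(z in Z) #|star (inner pi G) z|.
    rewrite sum_star -sum1_card; apply: leq_sum => e eI.
    have [eG eM] := innerP eI.
    have [a ae] : exists a, a \in e.
      by apply/card_gt0P; move: (subsetP sG _ eG); rewrite inE => /eqP->.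
    have [b ab eE] := edge_otherP (subsetP sG _ eG) ae.
    apply: contraT; rewrite -eqn0Ngt cards_eq0 => /eqP eZ.
    have nZ c : c \in e -> c \notin Z.
      by move=> ce; apply/negP=> cZ'; have : c \in e :&: Z; [rewrite inE ce | rewrite eZ inE].
    have be : b \in e by rewrite eE set22.
    have := rhoP a; have := rhoP b; rewrite /ok !rhoY (negPf (nZ a ae)) (negPf (nZ b be)) /=.
    rewrite (pi_rho b a) => [|]; last exact: eM.
    by move=> bU aU; have := U_ind _ _ _ (rhoY a) aU bU; rewrite -eE eG.
  apply: leq_trans le1 _; apply: (@leq_trans (\sum_(z in Z) (D2 + Zb))); last first.
    by rewrite sum_nat_const leq_mul2r cZ orbT.
  apply: leq_sum => z zZ; rewrite nbr_star //.
  have /andP[_] := rhoP z; rewrite zZ => leD.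
  apply: leq_trans (leq_add leD cZ); apply: leq_trans (leq_card_setU _ _).
  apply: subset_leq_card; apply/subsetP=> y; rewrite inE => zyI.
  have [zyG zyM] := innerP zyI.
  rewrite in_setU; case: (boolP (y \in Z)) => yZ; first by rewrite orbT.
  rewrite orbF in_setI inE zyG /=.
  have := rhoP y; rewrite /ok rhoY (negPf yZ) /= (pi_rho y z) //.
  by apply: zyM; rewrite ?set21 ?set22.
move=> i.
have [x xY px] : exists2 x, x \in Y & cast_ord cY (enum_rank_in x1Y x) = i.
  exists (enum_val (cast_ord (esym cY) i)); first exact: enum_valP.
  by rewrite enum_valK_in cast_ordKV.
have sU : U x \subset [set y | pi y == i].
  apply/subsetP=> y yU; rewrite inE -px /pi; apply/eqP; congr (cast_ord _ (enum_rank_in _ _)).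
  have yZ : y \notin Z by move: yU; rewrite inE => /andP[].
  have := rhoP y; rewrite /ok rhoY (negPf yZ) /= => yU'.
  exact: U_uniq yU' yU.
have := subset_leq_card sU; move: (cT x xY) q_lt pq; rewrite (mulnC q p) mulnS.
by move: (p.-1 * q.+1) (p * q) => r s; move: Zb => zb; arith_generalize; lia.
Qed.

End Structure.

(** * Exchanging edges according to their colours *)

(** One representative for each colour. *)
Lemma transversal_of (aT rT : finType) (c : aT -> rT) (P : {set aT}) :
  exists P' : {set aT}, [/\ P' \subset P, {in P' &, injective c} & c @: P' = c @: P].
Proof.
have [->|[x0 x0P]] := set_0Vmem P.
  by exists set0; rewrite sub0set imset0; split=> // x y; rewrite inE.
pose f d := odflt x0 [pick e in P | c e == d].
have fP d : d \in c @: P -> f d \in P /\ c (f d) = d.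
  case/imsetP=> x xP ->; rewrite /f; case: pickP => [y /andP[yP /eqP]|/(_ x)] //=.
  by rewrite xP eqxx.
exists (f @: (c @: P)); split.
- by apply/subsetP=> _ /imsetP[d /fP[fd _] ->].
- by move=> _ _ /imsetP[d /fP[_ cd] ->] /imsetP[d' /fP[_ cd'] ->]; rewrite cd cd' => ->.
- apply/setP=> d; apply/idP/idP => [/imsetP[_ /imsetP[d' d'P ->] ->]|dP].
    by have [_ ->] := fP _ d'P.
  by have [_ <-] := fP _ dP; rewrite imset_f // imset_f.
Qed.

Lemma disjoint_pairs (T : finType) (Q : {set T}) N :
  2 * N <= #|Q| ->
  exists P : {set {set T}},
    [/\ trivIset P, #|P| = N & {in P, forall e : {set T}, #|e| = 2 /\ e \subset Q}].
Proof.
elim: N Q => [|N IHN] Q card_Q.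
  exists set0; rewrite cards0; split=> // [|e]; last by rewrite inE.
  by apply/trivIsetP=> A B; rewrite inE.
have /card_gt1P[x [y [xQ yQ xy]]] : 1 < #|Q| by lia.
have sxy : [set x; y] \subset Q by rewrite subUset !sub1set xQ.
have [|P [tP cP hP]] := IHN (Q :\: [set x; y]).
  by rewrite cardsDS // cards2 xy; lia.
have P0 : set0 \notin P by apply/negP=> /hP[]; rewrite cards0.
have [B BP|tU xyP] := @trivIsetU1 _ [set x; y] P _ tP P0.
  have [_ /subsetP sB] := hP B BP; apply/pred0P=> z /=; apply/negP=> /andP[zxy /sB].
  by rewrite inE zxy.
exists ([set x; y] |: P); rewrite cardsU1 xyP cP; split=> //.
move=> e /setU1P[->|/hP[-> sB]]; first by rewrite cards2 xy.
by split=> //; apply: subset_trans sB _; apply: subsetDl.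
Qed.

Lemma matching_number_add1 (T : finType) (H : {set {set T}}) e :
  matching_number (e |: H) <= (matching_number H).+1.
Proof.
have [N mN <-] := matching_number_witness (e |: H); rewrite (cardsD1 e N).
rewrite -add1n; apply: leq_add; first by case: (e \in N).
apply: leq_matching_number; case/andP: mN => /subsetP sN tN; apply/andP; split.
  by apply/subsetP=> f /setD1P[fe /sN /setU1P[fe'|//]]; rewrite fe' eqxx in fe.
by apply: trivIsetS tN; apply: subsetDl.
Qed.

Section Swaps.
Variables (T I : finType) (pi : T -> I).
Implicit Types (e f : {set T}) (G H P : {set {set T}}) (u v w x y : T).

Lemma inner_mono G G' : G \subset G' -> inner pi G \subset inner pi G'.
Proof. by move=> /subsetP s; apply/subsetP=> e; rewrite !inE => /andP[/s-> ->]. Qed.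

Lemma seen_mono G G' v : G \subset G' -> seen pi G v \subset seen pi G' v.
Proof.
move=> s; apply/subsetP=> e; rewrite !inE => /andP[eI /forall_inP h].
have := subsetP (inner_mono s) e; rewrite !inE => -> //=.
by apply/forall_inP=> x /h/andP[-> /(subsetP s)].
Qed.

Lemma star_mono (H H' : {set {set T}}) v : H \subset H' -> star H v \subset star H' v.
Proof. by move=> /subsetP s; apply/subsetP=> e; rewrite !inE => /andP[/s-> ->]. Qed.

Lemma fan_number_mono G G' v : G \subset G' -> fan_number pi G v <= fan_number pi G' v.
Proof.
move=> s; apply: leq_add; last exact/matching_number_mono/seen_mono.
by apply/subset_leq_card/star_mono/inner_mono.
Qed.

(** The excess of inner edges over missing edges is the difference between the
    size of G and that of the complete multipartite graph. *)
Lemma inner_missing G : G \subset complete T ->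
  #|inner pi G| + #|cross [set: T] pi| = #|G| + #|missing pi G|.
Proof.
move=> sG.
have -> : #|cross [set: T] pi| = #|G :\: inner pi G| + #|missing pi G|.
  rewrite -(cardsID G (cross _ _)); congr (_ + _); apply: eq_card => e.
    rewrite !inE subsetT; case eG : (e \in G); last by rewrite !andbF.
    by have := subsetP sG e eG; rewrite inE => ->; rewrite andbT.
  by rewrite !inE subsetT /=; case: (e \in G); rewrite /= ?andbF ?andbT.
have sI : inner pi G \subset G by apply/subsetP=> e; rewrite inE => /andP[].
by rewrite addnA -(cardsID (inner pi G) G) (setIidPr sI).
Qed.

Lemma clean_congr G G' x :
  (forall e, x \in e -> (e \in G') = (e \in G)) -> clean pi G x -> clean pi G' x.
Proof.
move=> h /forallP cx; apply/forallP=> y; rewrite h ?set21 //; exact: cx.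
Qed.

Lemma unclean_cover G : G \subset complete T ->
  [set x | ~~ clean pi G x] \subset cover (inner pi G) :|: cover (missing pi G).
Proof.
move=> sG; apply/subsetP=> x; rewrite inE negb_forall => /existsP[y].
rewrite negb_imply => /andP[xy neq]; rewrite inE; apply/orP.
case xyG : ([set x; y] \in G) neq => neq.
  left; apply/coverP; exists [set x; y]; rewrite ?set21 // inE xyG mono_pair.
  by move: neq; case: (pi x == pi y).
right; apply/coverP; exists [set x; y]; rewrite ?set21 // inE set2_complete xy mono_pair xyG.
by move: neq; case: (pi x == pi y).
Qed.

Lemma matching_number_seen_add G x y v :
  G \subset complete T -> clean pi G x -> clean pi G y -> x != y ->
  pi x = pi y -> pi v != pi x ->
  matching_number (seen pi G v) < matching_number (seen pi ([set x; y] |: G) v).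
Proof.
move=> sG cx cy xy pxy pv; set e := [set x; y].
have [N mN <-] := matching_number_witness (seen pi G v).
have sGe : G \subset e |: G by apply: subsetUr.
have sGe' : e |: G \subset complete T by rewrite subUset sub1set set2_complete xy.
have mN' : matching (seen pi (e |: G) v) N by apply: matchingS mN; apply: seen_mono.
have eS : e \in seen pi (e |: G) v.
  have adj z : clean pi G z -> pi v != pi z -> [set v; z] \in G.
    by move=> cz vz; rewrite setUC; apply: (clean_adj cz); rewrite eq_sym.
  rewrite !inE eqxx mono_pair pxy eqxx /=; apply/forall_inP=> z ze.
  have [cz pz] : clean pi G z /\ pi z = pi x by case/set2P: ze => ->.
  by rewrite pz eq_sym pv in_setU1 adj ?orbT // pz.
have dis : [disjoint e & cover N].
  apply/pred0P=> z; apply/negP=> /andP[/= ze /coverP[f fN zf]].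
  have fI : f \in inner pi G.
    by apply: (subsetP (seen_inner pi G v)); case/andP: mN => /subsetP sN _; apply: sN.
  have cz : clean pi G z by case/set2P: ze => ->.
  by have := clean_inner sG cz fI; rewrite zf.
have sI : seen pi (e |: G) v \subset complete T.
  by apply: subset_trans (seen_inner _ _ _) _; apply: inner_complete.
have [mN2 <-] := matching_add sI mN' eS dis.
exact: leq_matching_number.
Qed.

End Swaps.

(** The surplus 2 in the hypothesis big is what makes the argument work: after the
    removal of one edge some vertex still has fan number at least k. *)
Section ColourArgument.
Variables (T D : finType) (k p q g X Y : nat) (c : {set T} -> D).
Variables (G : {set {set T}}) (pi : T -> 'I_p).
Implicit Types (e f : {set T}) (P : {set {set T}}) (A : {set D}) (u v x y : T).
Hypothesis k_gt0 : 0 < k.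
Hypothesis p_gt1 : 1 < p.
Hypothesis sG : G \subset complete T.
Hypothesis cG : {in G &, injective c}.
Hypothesis free : forall G' : {set {set T}},
  G' \subset complete T -> {in G' &, injective c} -> ~ has_fan G' k.+1 p.
Hypothesis gP : sparse_bound k.-1 g.
Hypothesis big : #|cross [set: T] pi| + g + 2 <= #|G|.
Hypothesis inner_le : #|inner pi G| <= X.
Hypothesis part_gt : forall i, q < #|[set x | pi x == i]| + Y.
Hypothesis q_large : Y + 4 * X + 17 * k + 5 <= q.

(** N disjoint pairs of clean vertices are taken in each of two classes.  Their at
    most 2k colours occur on edges of G that touch at most 4k vertices, so that
    some pair in each class is untouched. *)
Let N := (4 * k).+1.
Let Q i := [set x | clean pi G x && (pi x == i)].
Let removed A := [set e in G | c e \in A].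
Let del A := [set e in G | c e \notin A].
(** The rainbow graph obtained from G by adding the edges of P in place of the
    edges of G with the same colours. *)
Let swap P := P :|: del (c @: P).

Let card_Q i : 4 * N + k + 1 < #|Q i|.
Proof.
have c1 := card_cover_le (inner_complete pi sG).
have sM : missing pi G \subset complete T.
  by apply/subsetP=> e; rewrite inE => /and3P[].
have c2 := card_cover_le sM.
have le := inner_missing pi sG.
have un := subset_leq_card (unclean_cover pi sG).
have un2 : #|cover (inner pi G) :|: cover (missing pi G)| <=
    #|cover (inner pi G)| + #|cover (missing pi G)| by apply: leq_card_setU.
have cV := cardsID [set x | ~~ clean pi G x] [set x | pi x == i].
have le3 : #|[set x | pi x == i] :&: [set x | ~~ clean pi G x]| <= #|[set x | ~~ clean pi G x]|.
  by apply/subset_leq_card/subsetIr.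
have eQ : [set x | pi x == i] :\: [set x | ~~ clean pi G x] = Q i.
  by apply/setP=> x; rewrite !inE negbK.
rewrite {}eQ in cV; have := part_gt i; move: big inner_le q_large; rewrite /N.
by slia.
Qed.

Let card_removed A : #|removed A| <= #|A|.
Proof.
rewrite -(@card_in_imset _ _ c).
  by apply/subset_leq_card/subsetP=> _ /imsetP[e + ->]; rewrite inE => /andP[].
by move=> e f; rewrite !inE => /andP[eG _] /andP[fG _]; apply: cG.
Qed.

Let removed_complete A : removed A \subset complete T.
Proof. by apply: subset_trans sG; apply/subsetP=> e; rewrite inE => /andP[]. Qed.

Let card_del A : #|G| <= #|del A| + #|A|.
Proof.
have := card_removed A; rewrite -(cardsID (del A) G) => le; apply: leq_add.
  by apply/subset_leq_card/subsetIr.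
apply: leq_trans le; apply/subset_leq_card/subsetP=> e.
by rewrite !inE => /andP[+ eG]; rewrite eG /= negbK.
Qed.

Let sub_del A : del A \subset G.
Proof. by apply/subsetP=> e; rewrite inE => /andP[]. Qed.

Let sdel A : del A \subset complete T.
Proof. exact: subset_trans (sub_del A) sG. Qed.

Let clean_del A x :
  clean pi G x -> x \notin cover (removed A) -> clean pi (del A) x.
Proof.
move=> cx xR; apply: clean_congr cx => e xe; rewrite inE.
case eG : (e \in G) => //=; apply/negP=> eA; case/negP: xR; apply/coverP.
by exists e; rewrite // inE eG.
Qed.

Let clean_swap P x :
  clean pi G x -> x \notin cover P -> x \notin cover (removed (c @: P)) ->
  clean pi (swap P) x.
Proof.
move=> cx xP xR; have := clean_del cx xR; apply: clean_congr => e xe.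
rewrite in_setU; case eP : (e \in P) => //=.
by case/negP: xP; apply/coverP; exists e.
Qed.

Let swap_complete P : P \subset complete T -> swap P \subset complete T.
Proof. by move=> sP; rewrite subUset sP sdel. Qed.

Let swap_free P v :
  P \subset complete T -> {in P &, injective c} -> #|P| <= N ->
  fan_number pi (swap P) v <= k.
Proof.
move=> sP cP leN; rewrite leqNgt; apply/negP=> kv.
have ss := swap_complete sP.
apply: (free ss).
  move=> e f /setUP[eP|eD] /setUP[fP|fD] ef; first exact: cP.
  - by move: fD; rewrite inE -ef imset_f // andbF.
  - by move: eD; rewrite inE ef imset_f // andbF.
  - by apply: cG => //; apply: (subsetP (sub_del (c @: P))).
rewrite -[p]card_ord; apply: (has_fan_fan_number ss) kv => i.
have sQ : Q i :\: (cover P :|: cover (removed (c @: P))) \subset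
    [set x | clean pi (swap P) x && (pi x == i)].
  apply/subsetP=> x; rewrite !inE negb_or => /andP[/andP[xP xR] /andP[cx ->]].
  by rewrite clean_swap.
apply: leq_trans (subset_leq_card sQ).
have cD := cardsID (cover P :|: cover (removed (c @: P))) (Q i).
have le1 : #|Q i :&: (cover P :|: cover (removed (c @: P)))| <=
    #|cover P :|: cover (removed (c @: P))| by apply/subset_leq_card/subsetIr.
have le2 : #|cover P :|: cover (removed (c @: P))| <=
    #|cover P| + #|cover (removed (c @: P))| by apply: leq_card_setU.
have le3 := card_cover_le sP.
have le4 := card_cover_le (removed_complete (c @: P)).
have le5 := card_removed (c @: P).
have le6 := leq_imset_card c P.
have := card_Q i; move: leN; rewrite /N; slia.
Qed.

Let other (i : 'I_p) : exists j : 'I_p, j != i.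
Proof.
have /card_gt1P[j [j' [_ _ jj']]] : 1 < #|'I_p| by rewrite card_ord.
by have [<-|ji] := eqVneq j i; [exists j'; rewrite eq_sym | exists j].
Qed.

(** A clean vertex u of another class sees all the pairs of P; k + 1 of them with
    distinct colours would make u the centre of a rainbow fan. *)
Let few_colours i P :
  trivIset P -> #|P| = N -> {in P, forall e, #|e| = 2 /\ e \subset Q i} ->
  #|c @: P| <= k.
Proof.
move=> tP cP hP; have [P' [sP' cP' <-]] := transversal_of c P.
rewrite (card_in_imset cP') leqNgt; apply/negP=> kP'.
have leN : #|P'| <= N by rewrite -cP; apply: subset_leq_card.
have sPc : P' \subset complete T.
  by apply/subsetP=> e /(subsetP sP')/hP[ce _]; rewrite inE ce.
have [j ji] := other i.
have /card_gt0P[u] : 0 < #|Q j :\: cover (removed (c @: P'))|.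
  have cD := cardsID (cover (removed (c @: P'))) (Q j).
  have le1 : #|Q j :&: cover (removed (c @: P'))| <= #|cover (removed (c @: P'))|.
    by apply/subset_leq_card/subsetIr.
  have le4 := card_cover_le (removed_complete (c @: P')).
  have le5 := card_removed (c @: P').
  have le6 := leq_imset_card c P'.
  have := card_Q j; move: leN; rewrite /N; slia.
rewrite !inE => /andP[uR /andP[cu /eqP pu]].
have PQ e x : e \in P' -> x \in e -> pi x = i.
  move=> /(subsetP sP')/hP[_ /subsetP sQ] /sQ; rewrite inE => /andP[_ /eqP//].
have uP : u \notin cover P'.
  apply/negP=> /coverP[e eP ue]; move: ji; rewrite -(PQ e u eP ue) -pu eqxx //.
have cu' := clean_swap cu uP uR.
have := swap_free u sPc cP' leN; rewrite leqNgt => /negP; apply.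
apply: leq_trans kP' _; apply: leq_trans (leq_addl _ _).
apply: leq_matching_number; apply/andP; split; last exact: trivIsetS sP' tP.
apply/subsetP=> e eP; apply: clean_seen => // [|y ye].
  rewrite inE in_setU eP /=; apply/forall_inP=> x xe; apply/forall_inP=> y ye.
  by rewrite (PQ e) // (PQ e).
by rewrite (PQ e) // pu eq_sym.
Qed.

(** An edge e inside class i that can be added to G in exchange for the edge of its
    colour without affecting its own ends. *)
Let spare i e :=
  [/\ e \in complete T, e \subset Q i & [disjoint e & cover (removed [set c e])]].

Let spare_clean i e A x : spare i e -> x \in e -> [disjoint e & cover (removed A)] ->
  clean pi (del A) x /\ pi x = i.
Proof.
move=> [_ /subsetP sQ _] xe dis; have := sQ x xe; rewrite inE => /andP[cx /eqP->].
split=> //; apply: clean_del => //; apply/negP=> xR.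
by have /pred0P/(_ x) := dis; rewrite /= xe xR.
Qed.

Let spare_pair i e A : spare i e -> [disjoint e & cover (removed A)] ->
  exists x y, [/\ e = [set x; y], x != y & [/\ clean pi (del A) x, clean pi (del A) y,
     pi x = i & pi y = i]].
Proof.
move=> se dis; have [ce _ _] := se.
have [x xe] : exists x, x \in e by apply/card_gt0P; move: ce; rewrite inE => /eqP->.
have [y xy eE] := edge_otherP ce xe; exists x, y; split=> //.
have [cx px] := spare_clean se xe dis.
have ye : y \in e by rewrite eE set22.
by have [cy py] := spare_clean se ye dis.
Qed.

(** After the exchange a centre outside class i could use e for an additional
    clique. *)
Let spare_centre i e : spare i e ->
  (exists v, k <= fan_number pi (del [set c e]) v) /\
  forall v, k <= fan_number pi (del [set c e]) v -> pi v = i.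
Proof.
move=> se; have [ce eQ dis] := se.
have sd := sdel [set c e]; split.
  case: (boolP [exists v, k <= fan_number pi (del [set c e]) v]) => [/existsP//|].
  rewrite negb_exists => /forallP small.
  have I2 : 1 < #|'I_p| by rewrite card_ord.
  have cl j : exists2 x, clean pi (del [set c e]) x & pi x = j.
    have /card_gt0P[u] : 0 < #|Q j :\: cover (removed [set c e])|.
      have cD := cardsID (cover (removed [set c e])) (Q j).
      have le1 : #|Q j :&: cover (removed [set c e])| <= #|cover (removed [set c e])|.
        by apply/subset_leq_card/subsetIr.
      have le4 := card_cover_le (removed_complete [set c e]).
      have le5 := card_removed [set c e]; rewrite cards1 in le5.
      have := card_Q j; rewrite /N; slia.
    rewrite !inE => /andP[uR /andP[cu /eqP pu]]; exists u => //.
    exact: clean_del.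
  have K v : fan_number pi (del [set c e]) v <= k.-1.
    by have := small v; rewrite -ltnNge; case: (k) k_gt0.
  have := inner_missing pi sd; have := card_del [set c e]; rewrite cards1.
  by case: (inner_edges_bound sd I2 gP cl K) => [[le _]|le]; move: le big; slia.
move=> v kv; apply/eqP; apply: contraT => vi.
have [x [y [eE xy [cx cy px py]]]] := spare_pair se dis.
have sP : [set e] \subset complete T by rewrite sub1set.
have iP : {in [set e] &, injective c} by move=> a b /set1P-> /set1P->.
have := swap_free v sP iP; rewrite cards1 => /(_ isT); rewrite leqNgt => /negP[].
apply: leq_ltn_trans kv _; rewrite /swap imset_set1; subst e.
rewrite /fan_number -addnS; apply: leq_add.
  by apply/subset_leq_card/star_mono/inner_mono/subsetUr.
by apply: matching_number_seen_add => //; rewrite ?px ?py.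
Qed.

(** G0 has too many inner edges to be sparse with e1 added, so its matching number
    is at least k - 1.  All inner edges are outside class i2; hence an end x2 of e2
    sees k - 1 disjoint inner edges and e1, and e2 itself is a star at x2. *)
Let two_spares_absurd i1 i2 e1 e2 : i1 != i2 -> spare i1 e1 -> spare i2 e2 ->
  [disjoint e1 & cover (removed [set c e1; c e2])] ->
  [disjoint e2 & cover (removed [set c e1; c e2])] ->
  c e1 != c e2 ->
  let G0 := del [set c e1; c e2] in
  (forall v, fan_number pi G0 v <= k.-1) -> g <= #|inner pi G0| ->
  {in inner pi G0, forall e, {in e, forall x, pi x != i2}} -> False.
Proof.
move=> i12 s1 s2 d1 d2 c12 G0 small le_g away.
have sG0 : G0 \subset complete T := sdel _.
have [x1 [y1 [e1E xy1 [cx1 cy1 px1 py1]]]] := spare_pair s1 d1.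
have [x2 [y2 [e2E xy2 [cx2 cy2 px2 py2]]]] := spare_pair s2 d2.
rewrite -/G0 in cx1 cy1 cx2 cy2.
have sI := inner_complete pi sG0.
have nuK : k.-1 <= matching_number (inner pi G0).
  rewrite leqNgt; apply/negP=> lt.
  have e1I : e1 \notin inner pi G0.
    by apply/negP=> e1I; have := clean_inner sG0 cx1 e1I; rewrite e1E set21.
  have : #|e1 |: inner pi G0| <= g.
    apply: gP; last exact: leq_trans (matching_number_add1 _ _) lt.
      by rewrite subUset sub1set sI e1E set2_complete xy1.
    move=> v; case: (boolP (v \in e1)) => ve.
      have cv : clean pi G0 v by move: ve; rewrite e1E => /set2P[]->.
      apply: leq_trans (_ : 0 < _); last by apply: leq_ltn_trans lt.
      rewrite -(cards1 e1); apply: subset_leq_card; apply/subsetP=> f.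
      rewrite inE => /andP[/setU1P[->|fI] vf]; first exact: set11.
      by have := clean_inner sG0 cv fI; rewrite vf.
    apply: leq_trans (small v); apply: leq_trans (leq_addr _ _).
    apply: subset_leq_card; apply/subsetP=> f; rewrite inE => /andP[/setU1P[->|fI] vf].
      by rewrite vf in ve.
    by rewrite inE fI.
  by rewrite cardsU1 e1I ltnNge le_g.
pose P := [set e1; e2].
have sP : P \subset complete T.
  by rewrite subUset !sub1set e1E e2E !set2_complete xy1.
have iP : {in P &, injective c}.
  by move=> a b /set2P[]-> /set2P[]-> // ce; move: c12; rewrite ce eqxx.
have cPE : c @: P = [set c e1; c e2] by rewrite imsetU1 imset_set1.
have leP : #|P| <= N by rewrite cards2 /N ltnS; case: (e1 != e2); move: k_gt0; slia.
have := swap_free x2 sP iP leP.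
rewrite leqNgt => /negP; apply.
have swE : swap P = e2 |: (e1 |: G0) by rewrite /swap cPE -/G0 /P setUCA setUA.
have sG1 : e1 |: G0 \subset complete T by rewrite subUset sub1set sG0 e1E set2_complete xy1.
have lt1 : matching_number (seen pi G0 x2) < matching_number (seen pi (e1 |: G0) x2).
  rewrite e1E; apply: matching_number_seen_add => //; first by rewrite px1 py1.
  by rewrite px2 px1 eq_sym.
have seenE : inner pi G0 \subset seen pi G0 x2.
  apply/subsetP=> f fI; apply: clean_seen => // y yf.
  by rewrite px2; apply: away fI _ yf.
have le1 := matching_number_mono seenE.
have le2 : matching_number (seen pi (e1 |: G0) x2) <= matching_number (seen pi (swap P) x2).
  by apply/matching_number_mono/seen_mono; rewrite swE subsetUr.
have le3 : 0 < #|star (inner pi (swap P)) x2|.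
  apply/card_gt0P; exists e2; rewrite swE !inE eqxx /= e2E mono_pair px2 py2 eqxx.
  by rewrite set21.
by rewrite /fan_number; move: k_gt0 nuK lt1 le1 le2 le3; slia.
Qed.

(** Take spare edges e1 and e2 in two classes, and let G0 be G without the edges of
    their colours.  A vertex with fan number k in G0 would lie in both
    classes by [spare_centre], so there is none and G0 is extremal in the sense
    of [inner_edges_bound].  Hence its inner edges lie in a single class, which
    is not the class of e1 or not that of e2. *)
Lemma colour_argument : False.
Proof.
have [i1 _] : exists i : 'I_p, i \in 'I_p.
  by apply/card_gt0P; rewrite card_ord; apply: ltnW.
have [i2 i21] := other i1.
have N2 i : 2 * N <= #|Q i| by have := card_Q i; lia.
have [P1 [tP1 cP1 hP1]] := disjoint_pairs (N2 i1).
have [P2 [tP2 cP2 hP2]] := disjoint_pairs (N2 i2).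
have k1 := few_colours tP1 cP1 hP1; have k2 := few_colours tP2 cP2 hP2.
pose A := c @: P1 :|: c @: P2; pose R := cover (removed A).
have cR : #|R| < N.
  have := card_cover_le (removed_complete A); have := card_removed A; rewrite -/R.
  have : #|A| <= #|c @: P1| + #|c @: P2| by apply: leq_card_setU.
  by rewrite /N; slia.
have untouched P : trivIset P -> #|P| = N -> exists2 e, e \in P & [disjoint e & R].
  move=> tP cP; have := card_meets R tP => meet.
  have /card_gt0P[e] : 0 < #|P :&: [set e : {set T} | [disjoint e & R]]|.
    by have := cardsID [set e : {set T} | [disjoint e & R]] P; rewrite cP; move: meet cR; slia.
  by rewrite !inE => /andP[eP dis]; exists e.
have [e1 e1P d1] := untouched P1 tP1 cP1.
have [e2 e2P d2] := untouched P2 tP2 cP2.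
have removedS A' : A' \subset A -> cover (removed A') \subset R.
  move=> /subsetP sA; apply/subsetP=> x /coverP[e]; rewrite inE => /andP[eG /sA eA] xe.
  by apply/coverP; exists e; rewrite // inE eG.
have c1A : c e1 \in A by rewrite inE imset_f.
have c2A : c e2 \in A by rewrite inE [X in _ || X]imset_f ?orbT.
have s12 : [set c e1; c e2] \subset A by rewrite subUset !sub1set c1A.
have disR e A' : [disjoint e & R] -> A' \subset A -> [disjoint e & cover (removed A')].
  by move=> dis /removedS sR; apply: disjointWr dis.
have sp1 : spare i1 e1.
  have [ce eQ] := hP1 e1 e1P; split; rewrite ?inE ?ce //.
  by apply: disR; rewrite // sub1set.
have sp2 : spare i2 e2.
  have [ce eQ] := hP2 e2 e2P; split; rewrite ?inE ?ce //.
  by apply: disR; rewrite // sub1set.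
have [_ in1] := spare_centre sp1; have [_ in2] := spare_centre sp2.
pose G0 := del [set c e1; c e2].
have sub1 e : e \in [set e1; e2] -> G0 \subset del [set c e].
  move=> ee; apply/subsetP=> f; rewrite !inE negb_or => /andP[-> /andP[f1 f2]].
  by case/set2P: ee => ->.
have small v : fan_number pi G0 v <= k.-1.
  rewrite -ltnS prednK // ltnNge; apply/negP=> kv.
  have h1 := in1 v (leq_trans kv (fan_number_mono _ _ (sub1 e1 (set21 _ _)))).
  have h2 := in2 v (leq_trans kv (fan_number_mono _ _ (sub1 e2 (set22 _ _)))).
  by move: i21; rewrite -h1 -h2 eqxx.
have sG0 : G0 \subset complete T := sdel _.
have I2 : 1 < #|'I_p| by rewrite card_ord.
have cl j : exists2 x, clean pi G0 x & pi x = j.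
  have /card_gt0P[u] : 0 < #|Q j :\: R|.
    have cD := cardsID R (Q j).
    have le1 : #|Q j :&: R| <= #|R| by apply/subset_leq_card/subsetIr.
    by have := card_Q j; move: cR; slia.
  rewrite !inE => /andP[uR /andP[cu /eqP pu]]; exists u => //.
  by apply: clean_del => //; apply: contra uR; apply/subsetP/removedS.
have inm := inner_missing pi sG0.
have cdel := card_del [set c e1; c e2]; rewrite cards2 -/G0 in cdel.
have [[le [i one]]|lt] := inner_edges_bound sG0 I2 gP cl small; last first.
  by move: big inm cdel lt; case: (c e1 != c e2); slia.
have c12 : c e1 != c e2.
  by apply: contraT => /negPf eqc; move: cdel; rewrite eqc /=; move: big inm le; slia.
have ge : g <= #|inner pi G0|.
  by rewrite c12 in cdel; move: big inm cdel; slia.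
have d1' : [disjoint e1 & cover (removed [set c e1; c e2])] by apply: disR.
have d2' : [disjoint e2 & cover (removed [set c e1; c e2])] by apply: disR.
have [ii2|ii2] := eqVneq i i2; last first.
  apply: (@two_spares_absurd i1 i2 e1 e2); rewrite // 1?eq_sym //.
  by move=> e eI x xe; rewrite (one e eI x xe).
apply: (@two_spares_absurd i2 i1 e2 e1); rewrite // 1?eq_sym // 1?(setUC [set c e2]) //.
by move=> e eI x xe; rewrite (one e eI x xe) ii2.
Qed.

End ColourArgument.

(** * Vertices of small degree *)
Section Deletion.
Variables (T : finType) (p : nat).
Hypothesis p_gt0 : 0 < p.
Implicit Types (W : {set T}) (G : {set {set T}}).

Definition induced G W := [set e in G | e \subset W].

(** Put v in the smallest class. *)
Lemma turan_add W v : v \notin W ->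
  turan p W + (#|W| - #|W| %/ p) <= turan p (v |: W).
Proof.
move=> vW.
have p0' : 0 < #|{ffun T -> 'I_p}| by apply/card_gt0P; exists [ffun=> Ordinal p_gt0].
have [pi eturan] := @eq_bigmax {ffun T -> 'I_p} (fun pi => #|cross W pi|) p0'.
rewrite {1}/turan {}eturan.
pose V i := [set x in W | pi x == i].
have [i Vi] : exists i, #|V i| <= #|W| %/ p.
  apply/existsP; apply: contraT; rewrite negb_exists => /forallP lt.
  have sumV : \sum_(i : 'I_p) #|V i| = #|W|.
    rewrite -[RHS]sum1_card (partition_big pi xpredT) //=.
    by apply: eq_bigr => i _; rewrite -sum1_card; apply: eq_bigl => x; rewrite inE.
  have : p * (#|W| %/ p).+1 <= #|W|.
    rewrite -{2}sumV -{1}[p]card_ord -sum_nat_const; apply: leq_sum => i _.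
    by have := lt i; rewrite -ltnNge.
  by rewrite mulnC leqNgt ltn_ceil.
pose pi' := [ffun x => if x == v then i else pi x].
apply: leq_trans (leq_bigmax (F := fun pi : {ffun T -> 'I_p} => #|cross (v |: W) pi|) pi').
pose S := [set [set v; x] | x in W :\: V i].
have neq x : x \in W -> x != v by move=> xW; apply: contraNneq vW => <-.
have cS : #|S| = #|W :\: V i|.
  apply: card_in_imset => x y /setDP[/neq xv _] /setDP[/neq yv _] exy.
  have : x \in [set v; y] by rewrite -exy set22.
  by rewrite !inE (negPf xv) => /eqP.
have le : #|W| - #|W| %/ p <= #|S|.
  rewrite cS cardsD; have -> : W :&: V i = V i.
    by apply/setIidPr/subsetP=> x; rewrite inE => /andP[].
  by apply: leq_sub2l.
have dis : cross W pi :&: S = set0.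
  apply/setP=> e; rewrite !inE; apply/negP=> /andP[/and3P[_ /subsetP sW _]].
  by case/imsetP=> x _ eE; case/negP: vW; apply: sW; rewrite eE set21.
apply: leq_trans (leq_add (leqnn _) le) _.
rewrite -[_ + _]subn0 -(@cards0 {set T}) -dis -cardsU.
apply: subset_leq_card; rewrite subUset; apply/andP; split; apply/subsetP=> e.
  rewrite !inE => /and3P[ce sW nm]; have /subsetP sW' := sW.
  have {}ce : e \in complete T by rewrite inE.
  have [x xe] : exists x, x \in e by apply/card_gt0P; move: ce; rewrite inE => /eqP->.
  have [y xy eE] := edge_otherP ce xe; rewrite eE !mono_pair in nm *.
  have xW := sW' x xe; have yW : y \in W by apply: sW'; rewrite eE set22.
  rewrite cards2 xy !ffunE (negPf (neq x xW)) (negPf (neq y yW)) nm andbT /=.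
  by rewrite subUset !sub1set !inE xW yW !orbT.
case/imsetP=> x /setDP[xW]; rewrite inE xW /= => xV ->.
rewrite inE set2_complete mono_pair !ffunE eqxx (negPf (neq x xW)) eq_sym (neq x xW) /=.
by rewrite subUset !sub1set !inE eqxx xW orbT /= eq_sym.
Qed.

Lemma card_induced_le G W : G \subset complete T -> #|induced G W| + #|W| <= #|W| ^ 2.
Proof.
move=> sG; have : #|induced G W| <= 'C(#|W|, 2).
  rewrite -cards_draws; apply/subset_leq_card/subsetP=> e.
  by rewrite !inE => /andP[/(subsetP sG)]; rewrite inE => -> ->.
move=> le; apply: leq_trans (_ : 'C(#|W|, 2) + #|W| <= _); first by rewrite leq_add2r.
elim: #|W| => [|w IHw]; first by rewrite bin0n.
rewrite binS bin1; move: IHw; move: 'C(w, 2) => b; nia.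
Qed.

(** Deleting a vertex whose degree is below the minimum degree of the Turan graph
    increases the surplus of edges over the Turan number.  The surplus is at most
    the number of edges of the remaining graph on W, so W cannot become small:
    it keeps at least about the square root of the original number of vertices. *)
Lemma dense_core G s :
  G \subset complete T -> turan p [set: T] + s <= #|G| -> 
  exists W : {set T},
    [/\ turan p W + s <= #|induced G W|, #|T| + s <= #|W| ^ 2 &
        {in W, forall v, #|W| <= #|star (induced G W) v| + (#|W|.-1 %/ p).+1}].
Proof.
move=> sG le0.
pose P W := turan p W + s + (#|T| - #|W|) <= #|induced G W|.
have P0 : P [set: T].
  rewrite /P cardsT subnn addn0; have -> // : induced G [set: T] = G.
  by apply/setP=> e; rewrite inE subsetT andbT.
have [W PW minW] : exists2 W, P W & forall W', P W' -> #|W| <= #|W'|.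
  by case: (arg_minnP (fun W : {set T} => #|W|) P0) => W; exists W.
have TW := max_card (mem W).
exists W; split; first by apply: leq_trans PW; apply: leq_addr.
  by have := card_induced_le W sG; move: PW TW; rewrite /P; slia.
move=> v vW; pose W' := W :\ v.
have cW : #|W| = #|W'|.+1 by rewrite (cardsD1 v) vW.
have nP : ~~ P W' by apply/negP=> /minW; rewrite cW ltnn.
have := turan_add (negbT (setD11 v W)); rewrite setD1K // => tadd.
have ind : #|induced G W| = #|induced G W'| + #|star (induced G W) v|.
  rewrite (card_rem_star _ v); congr (_ + _); apply: eq_card => e.
  by rewrite !inE subsetD1; case: (e \in G); case: (e \subset W); case: (v \in e).
move: nP PW; rewrite /P -ltnNge {}ind cW => lt ge.
have := leq_div #|W'| p; move: lt ge TW tadd; rewrite cW /=.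
move: (turan p W') (turan p W) (#|W'| %/ p) => t' t d.
by slia.
Qed.

End Deletion.

Lemma has_fan_imset (T U : finType) (h : U -> T) (G : {set {set U}}) k s :
  injective h -> has_fan G k s -> has_fan [set h @: (e : {set U}) | e in G] k s.
Proof.
move=> h_inj [v [C [cC vC clC dC]]]; exists (h v), (fun i => h @: C i); split.
- by move=> i /=; rewrite card_imset.
- by move=> i /=; rewrite mem_imset.
- move=> i; have CE : h v |: h @: C i = h @: (v |: C i) by rewrite imsetU1.
  apply/cliqueP=> x y; rewrite CE => /imsetP[a aC ->] /imsetP[b bC ->] ab.
  have -> : [set h a; h b] = h @: [set a; b] by rewrite imsetU1 imset_set1.
  apply: imset_f.
  by have /cliqueP := clC i; apply=> //; apply: contraNneq ab => ->.
- move=> i j /dC; rewrite -!setI_eq0 -imsetI; last by move=> x y _ _; apply: h_inj.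
  by move=> /eqP->; rewrite imset0.
Qed.

(** The square root of 256 (k + 1) ^ 5 (p + 1) ^ 16 is at least
    16 (k + 1) ^ 2 (p + 1) ^ 8, which exceeds the constants of [partition_exists]
    and [colour_argument]; these are at most 210 k ^ 2 p ^ 3. *)
Lemma size_bound k p w :
  0 < k -> 1 < p -> 256 * (k + 1) ^ 5 * p.+1 ^ 16 <= w ^ 2 ->
  (4 * k * p + p + p +
    4 * ((4 * k * p + p) * (p.-1 * (4 * k * p + 2 * p) + k * p + (4 * k * p + p))) +
    17 * k + 5) * p < w.
Proof.
move=> k0 p1 hw; pose Z := 4 * k * p + p; rewrite -/Z.
pose X := Z * (p.-1 * (4 * k * p + 2 * p) + k * p + Z); rewrite -/X.
have w_ge : 16 * (k + 1) ^ 2 * p.+1 ^ 8 <= w.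
  rewrite -leq_sqr; apply: leq_trans hw.
  rewrite expnMn (expnMn 16) -(expnM (k + 1)) -(expnM p.+1) leq_mul2r; apply/orP; right.
  by rewrite leq_mul2l /= leq_pexp2l // addn1.
apply: leq_trans w_ge; clear hw.
pose m := k * p.
have pm : p <= m by rewrite /m leq_pmull.
have km : k <= m by rewrite /m leq_pmulr // ltnW.
have Zm : Z <= 5 * m by rewrite /Z -mulnA -/m; lia.
have mp : 2 * m <= m * p by rewrite mulnC leq_mul2l p1 orbT.
have D2m : p.-1 * (4 * k * p + 2 * p) + k * p <= 6 * (m * p).
  have -> : 6 * (m * p) = p.-1 * (6 * m) + 6 * m.
    by rewrite mulnCA mulnC -{1}(prednK (ltnW p1)); ring.
  apply: leq_add; last by rewrite -/m; lia.
  by rewrite leq_mul2l; apply/orP; right; rewrite -mulnA -/m; lia.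
have Xm : X <= 5 * m * (9 * (m * p)).
  have add9 d y z : d <= 6 * y -> 2 * m <= y -> z <= 5 * m -> d + z <= 9 * y by clear; lia.
  by apply: leq_mul => //; apply: add9.
have m1 : m <= m * (m * p) by rewrite leq_pmulr // !muln_gt0 k0 ltnW //= ltnW.
have tot : Z + p + 4 * X + 17 * k + 5 <= 210 * (m * (m * p)).
  have E45 : 5 * m * (9 * (m * p)) = 45 * (m * (m * p)) by ring.
  rewrite E45 in Xm.
  by move: (m * (m * p)) Xm m1 => y; lia.
apply: (@leq_ltn_trans (210 * (m * (m * p)) * p)); first by rewrite leq_mul2r tot orbT.
have -> : 210 * (m * (m * p)) * p = 210 * (k ^ 2 * p ^ 4) by rewrite /m; ring.
have k2 : k ^ 2 <= (k + 1) ^ 2 by rewrite leq_sqr leq_addr.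
have p4 : p ^ 4 <= p.+1 ^ 4 by rewrite leq_exp2r.
have p4' : 81 <= p.+1 ^ 4 by rewrite -[81]/(3 ^ 4) leq_exp2r.
have -> : 16 * (k + 1) ^ 2 * p.+1 ^ 8 = 16 * ((k + 1) ^ 2 * (p.+1 ^ 4 * p.+1 ^ 4)).
  by rewrite -expnD mulnA.
have le : k ^ 2 * p ^ 4 * 81 <= (k + 1) ^ 2 * (p.+1 ^ 4 * p.+1 ^ 4).
  by rewrite -mulnA; apply: leq_mul => //; apply: leq_mul.
have pos : 0 < k ^ 2 * p ^ 4 by rewrite muln_gt0 !expn_gt0 k0 ltnW.
by move: (k ^ 2 * p ^ 4) ((k + 1) ^ 2 * (p.+1 ^ 4 * p.+1 ^ 4)) le pos => y z; lia.
Qed.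

(** The upper bound for cliques on at least three vertices: pass to the subgraph of
    [dense_core], as a graph on the subtype of its vertices. *)
Lemma rainbow_fan_dense n k p (D : finType) (c : {set 'I_n} -> D) (G : {set {set 'I_n}}) :
  0 < k -> 1 < p -> 256 * (k + 1) ^ 5 * p.+1 ^ 16 <= n ->
  G \subset complete 'I_n -> {in G &, injective c} ->
  ex n (fan k p.+1) + 2 <= #|G| ->
  (forall G' : {set {set 'I_n}},
     G' \subset complete 'I_n -> {in G' &, injective c} -> ~ has_fan G' k.+1 p) ->
  False.
Proof.
move=> k0 p1 hn sG cG big free; have p0 : 0 < p by apply: ltnW.
pose g := ex n (fan k p.+1) - turan p [set: 'I_n].
have gP : sparse_bound k.-1 g.
  apply: ex_sparse_bound => //; apply: leq_trans hn.
  apply: leq_mul.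
    apply: leq_mul => //; apply: leq_trans (_ : (k + 1) ^ 2 <= _).
      by rewrite leq_sqr leq_addr.
    by rewrite leq_pexp2l // addn1.
  by apply: leq_trans (leqnSn p) _; rewrite -{1}[p.+1]expn1 leq_pexp2l.
have tG : turan p [set: 'I_n] + (g + 2) <= #|G|.
  apply: leq_trans big; rewrite addnA leq_add2r subnKC //.
  exact: turan_le_ex.
have [W [tW cW dW]] := dense_core p0 sG tG.
have {}cW : n <= #|W| ^ 2.
  by apply: leq_trans cW; rewrite card_ord leq_addr.
pose U : finType := {x : 'I_n | x \in W}.
pose h (e : {set U}) : {set 'I_n} := val @: e.
have h_inj : injective h by apply/imset_inj/val_inj.
have hW e : h e \subset W by apply/subsetP=> _ /imsetP[u _ ->]; apply: valP.
have hK (e : {set 'I_n}) : e \subset W -> exists e', e = h e'.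
  move=> /subsetP sW; exists [set u | val u \in e]; apply/setP=> x.
  apply/idP/imsetP => [xe|[u]]; last by rewrite inE => ue ->.
  by exists (Sub x (sW x xe)); rewrite ?inE SubK.
have h_complete e : (h e \in complete 'I_n) = (e \in complete U).
  by rewrite !inE card_imset //; apply: val_inj.
pose GU := [set e : {set U} | h e \in G].
have sGU : GU \subset complete U.
  by apply/subsetP=> e; rewrite inE => /(subsetP sG); rewrite h_complete.
have hGU : h @: GU = induced G W.
  apply/setP=> e; apply/imsetP/idP => [[e' + ->]|].
    by rewrite !inE hW andbT.
  by rewrite inE => /andP[eG /hK[e' eE]]; exists e'; rewrite // inE -eE.
have cGU : #|GU| = #|induced G W| by rewrite -hGU card_imset.
pose cU e := c (h e).
have injU : {in GU &, injective cU}.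
  by move=> e f; rewrite !inE => eG fG /(cG _ _ eG fG)/h_inj.
have freeU (G' : {set {set U}}) :
    G' \subset complete U -> {in G' &, injective cU} -> ~ has_fan G' k.+1 p.
  move=> sG' cG' /(has_fan_imset val_inj); apply: free.
    by apply/subsetP=> _ /imsetP[e eG ->]; rewrite -/(h e) h_complete (subsetP sG').
  move=> _ _ /imsetP[e eG ->] /imsetP[f fG ->] eq_c.
  by rewrite (cG' e f).
have cUW : #|U| = #|W| by rewrite card_sig; apply: eq_card => x; rewrite inE.
have crossU (pi : U -> 'I_p) : #|cross [set: U] pi| <= turan p W.
  pose pi' : {ffun 'I_n -> 'I_p} :=
    [ffun x => if insub x is Some u then pi u else Ordinal p0].
  apply: leq_trans (leq_bigmax (F := fun pi : {ffun 'I_n -> 'I_p} => #|cross W pi|) pi').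
  rewrite -(card_imset _ h_inj); apply/subset_leq_card/subsetP=> _ /imsetP[e + ->].
  rewrite inE => /and3P[ce _ nm]; rewrite inE h_complete ce hW /=.
  apply: contra nm => /forall_inP me; apply/forall_inP=> x xe; apply/forall_inP=> y ye.
  have /forall_inP/(_ (val y) (imset_f _ ye)) := me _ (imset_f _ xe).
  by rewrite !ffunE !valK.
have n0 : 0 < n by apply: leq_trans hn; rewrite muln_gt0 (muln_gt0 256) !expn_gt0 addn1.
have W0 : 0 < #|W| by rewrite lt0n; apply: contraTneq cW => ->; rewrite -ltnNge.
pose q := #|W|.-1 %/ p.
have degU u : #|~: nbr GU u| <= q.+1.
  have stE : #|star GU u| = #|star (induced G W) (val u)|.
    rewrite -(card_imset _ h_inj); apply: eq_card => e; apply/imsetP/idP => [[e' + ->]|].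
      rewrite !inE => /andP[eG ue]; rewrite eG hW /=.
      by rewrite mem_imset //; apply: val_inj.
    rewrite !inE => /andP[/andP[eG /hK[e' eE]] ue]; exists e' => //.
    rewrite !inE -eE eG /=; move: ue; rewrite eE mem_imset //; exact: val_inj.
  have := dW _ (valP u); rewrite -stE nbr_star // -/q -cUW -(cardsC (nbr GU u)).
  by rewrite leq_add2l.
have q_lt : q * p < #|U|.
  by rewrite cUW -(prednK W0) ltnS; apply: leq_trunc_div.
have hw : 256 * (k + 1) ^ 5 * p.+1 ^ 16 <= #|W| ^ 2 by apply: leq_trans cW.
have := size_bound k0 p1 hw; move=> sb.
have q_ge : 4 * k * p + p + p +
    4 * ((4 * k * p + p) * (p.-1 * (4 * k * p + 2 * p) + k * p + (4 * k * p + p))) +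
    17 * k + 5 <= q.
  rewrite /q leq_divRL // -ltnS prednK //.
have q_ge' : 2 * k * p + p <= q by apply: leq_trans q_ge; rewrite -!mulnA; lia.
have [pi [leI part]] := partition_exists sGU p1 (freeU _ sGU injU) degU q_lt q_ge'.
have part' i : q < #|[set x | pi x == i]| + (4 * k * p + p + p) by rewrite addnA.
apply: (colour_argument k0 p1 sGU injU freeU gP _ leI part' q_ge).
by rewrite -addnA cGU; apply: leq_trans tW; rewrite leq_add2r.
Qed.

(** * Rainbow stars *)
Lemma ex_star n k (G : {set {set 'I_n}}) :
  G \subset complete 'I_n -> (forall v, #|star G v| < k) -> #|G| <= ex n (fan k 2).
Proof.
move=> sG dG; rewrite /ex; apply: (bigmax_sup G) => //.
rewrite /simple_graph sG /=; apply/negP=> /contains_fanP /= /(has_fan_starP _ sG).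
by case/existsP=> v; rewrite leqNgt dG.
Qed.

Lemma add_matching (T : finType) k j (G : {set {set T}}) (Y : {set T}) :
  G \subset complete T -> (forall v, #|star G v| < k) ->
  {in Y, forall v, #|star G v| + 2 <= k} -> 2 * j + k <= #|Y| ->
  exists E : {set {set T}},
    [/\ E \subset complete T, forall v, #|star E v| < k & #|E| = #|G| + j].
Proof.
elim: j G Y => [|j IHj] G Y sG dG dY cY; first by exists G; rewrite addn0.
have [y yY] : exists y, y \in Y by apply/card_gt0P; apply: leq_trans cY; lia.
have /card_gt0P[z] : 0 < #|Y :\: (y |: nbr G y)|.
  have := cardsID (y |: nbr G y) Y.
  have : #|Y :&: (y |: nbr G y)| <= #|y |: nbr G y| by apply/subset_leq_card/subsetIr.
  have : #|y |: nbr G y| <= 1 + #|nbr G y| by rewrite -(cards1 y); apply: leq_card_setU.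
  by rewrite -nbr_star //; have := dY y yY; move: cY; slia.
rewrite !inE negb_or => /andP[/andP[zy yzG] zY].
pose E := [set y; z] |: G.
have sE : E \subset complete T by rewrite subUset sub1set sG set2_complete eq_sym zy.
have starE v : v \notin [set y; z] -> star E v = star G v.
  move=> vyz; apply/setP=> e; rewrite !inE; case: eqP => [->|] //=.
  by rewrite (negPf vyz) andbF.
have starE1 v : #|star E v| <= #|star G v| + 1.
  rewrite addn1 -add1n -(cards1 [set y; z]); apply: leq_trans (leq_card_setU _ _).
  apply/subset_leq_card/subsetP=> e; rewrite !inE => /andP[/orP[->//|->] ->].
  by rewrite orbT.
have dE v : #|star E v| < k.
  case: (boolP (v \in [set y; z])) => [vyz|/starE-> //].
  have vY : v \in Y by case/set2P: vyz => ->.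
  by have := starE1 v; have := dY v vY; slia.
have dY' : {in Y :\: [set y; z], forall v, #|star E v| + 2 <= k}.
  by move=> v /setDP[vY vyz]; rewrite starE //; apply: dY.
have cY' : 2 * j + k <= #|Y :\: [set y; z]|.
  have := cardsID [set y; z] Y.
  have : #|Y :&: [set y; z]| <= #|[set y; z]| by apply/subset_leq_card/subsetIr.
  by rewrite cards2 eq_sym zy; move: cY; slia.
have [E' [sE' dE' cE']] := IHj E _ sE dE dY' cY'.
by exists E'; split; rewrite // cE' cardsU1 yzG /= addnAC addnC.
Qed.

(** Without rainbow stars with k + 1 edges each vertex sees at most k colours.  A
    colour is big when it appears at L vertices or more; counting degrees, each
    vertex sees a big colour, so that representatives of the small colours
    have maximum degree less than k. *)
Section StarColouring.
Variables (T D : finType) (c : {set T} -> D) (k : nat).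
Implicit Types (v u : T) (a b : D).
Hypothesis k_gt0 : 0 < k.
Hypothesis free : forall G : {set {set T}},
  G \subset complete T -> {in G &, injective c} -> ~ has_fan G k.+1 1.
Hypothesis T_large : 2 * k * (8 * k ^ 2 + k) <= #|T|.

Let cols v := c @: star (complete T) v.
Let span a := cover [set e in complete T | c e == a].
Let L := #|T| %/ (2 * k).
Let bigs v := [set a in cols v | L <= #|span a|].

Let L_large : 8 * k ^ 2 + k <= L.
Proof. by rewrite /L leq_divRL ?muln_gt0 // mulnC. Qed.

Let L_small : 2 * k * L <= #|T|.
Proof. by rewrite mulnC; apply: leq_trunc_div. Qed.

Let cols_le v : #|cols v| <= k.
Proof.
rewrite leqNgt; apply/negP=> lt; rewrite /cols in lt.
have [P [sP cP eP]] := transversal_of c (star (complete T) v).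
have sPc : P \subset complete T.
  by apply: subset_trans sP _; apply/subsetP=> e; rewrite inE => /andP[].
apply: (free sPc cP); apply/(has_fan_starP _ sPc)/existsP; exists v.
rewrite -eP (card_in_imset cP) in lt; apply: leq_trans lt _.
apply/subset_leq_card/subsetP=> e eP'; have := subsetP sP e eP'.
by rewrite !inE eP' => /andP[_ ->].
Qed.

Let spanE v a : (v \in span a) = (a \in cols v).
Proof.
apply/coverP/imsetP => [[e]|[e]].
  by rewrite inE => /andP[ce /eqP <-] ve; exists e; rewrite // inE ce.
by rewrite inE => /andP[ce ve] ->; exists e; rewrite // inE ce eqxx.
Qed.

Let degree_sum v : #|T| <= (\sum_(a in cols v) #|span a|.-1).+1.
Proof.
have card_star : #|star (complete T) v| = #|T|.-1.
  rewrite nbr_star // -cardsT (cardsD1 v [set: T]) inE /=; congr #|pred_of_set _|.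
  by apply/setP=> x; rewrite inE set2_complete !inE eq_sym andbT.
have T0 : 0 < #|T| by apply/card_gt0P; exists v.
rewrite -(prednK T0) ltnS -card_star -sum1_card.
rewrite (partition_big c (mem (cols v))) /=; last by move=> e eS; apply: imset_f.
apply: leq_sum => a aC.
have va : v \in span a by rewrite spanE.
rewrite sum1_card; have -> : #|span a|.-1 = #|span a :\ v| by rewrite (cardsD1 v) va.
pose S := [set e in star (complete T) v | c e == a].
have -> : #|[pred e | (e \in star (complete T) v) && (c e == a)]| = #|S|.
  by apply: eq_card => e; rewrite !inE.
have sS : S \subset complete T by apply/subsetP=> e; rewrite !inE => /andP[/andP[]].
have -> : #|S| = #|star S v|.
  by apply: eq_card => e; rewrite !inE; case: (v \in e); rewrite ?andbF ?andbT.
rewrite nbr_star //; apply/subset_leq_card/subsetP=> y; rewrite inE => yS.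
have vy : v != y by move: (subsetP sS _ yS); rewrite set2_complete.
rewrite !inE eq_sym vy /=; apply/coverP; exists [set v; y]; rewrite ?set22 //.
by move: yS; rewrite !inE => /andP[/andP[-> _] ->].
Qed.

Let bigs_gt0 v : 0 < #|bigs v|.
Proof.
rewrite lt0n; apply: contraTneq (degree_sum v) => /eqP; rewrite cards_eq0 => /eqP b0.
have le : \sum_(a in cols v) #|span a|.-1 <= k * L.
  apply: (@leq_trans (\sum_(a in cols v) L)); last by rewrite sum_nat_const leq_mul2r cols_le orbT.
  apply: leq_sum => a aC; apply: leq_trans (leq_pred _) _.
  have : a \notin bigs v by rewrite b0 inE.
  by rewrite inE aC /= -ltnNge => /ltnW.
rewrite -ltnNge; apply: (@leq_ltn_trans (k * L).+1); first by rewrite ltnS.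
have : 0 < k * L by rewrite muln_gt0 k_gt0; apply: leq_trans L_large; rewrite addn_gt0 k_gt0 orbT.
by move: L_small; rewrite -mulnA; move: (k * L) => x; slia.
Qed.

(** A vertex seeing only one big colour has nearly all its edges in that colour. *)
Let unique_big v a : bigs v = [set a] -> #|T| <= #|span a| + k.-1 * L.
Proof.
move=> bE; have aB : a \in bigs v by rewrite bE set11.
have aC : a \in cols v by move: aB; rewrite inE => /andP[].
have := degree_sum v; rewrite (big_setD1 a) //= => le.
have le2 : \sum_(b in cols v :\ a) #|span b|.-1 <= k.-1 * L.
  apply: (@leq_trans (\sum_(b in cols v :\ a) L)).
    apply: leq_sum => b /setD1P[ba bC]; apply: leq_trans (leq_pred _) _.
    have : b \notin bigs v by rewrite bE inE.
    by rewrite inE bC /= -ltnNge => /ltnW.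
  rewrite sum_nat_const leq_mul2r; apply/orP; right.
  by have := cols_le v; rewrite (cardsD1 a) aC add1n; case: (k) k_gt0.
have sa : 0 < #|span a| by apply/card_gt0P; exists v; rewrite spanE.
by move: le le2 sa; move: (k.-1 * L) => x; slia.
Qed.

Let B := [set a in c @: complete T | L <= #|span a|].

Let card_B : #|B| <= 4 * k ^ 2.
Proof.
have le : #|B| * L <= k * #|T|.
  apply: (@leq_trans (\sum_(a in B) #|span a|)).
    by rewrite -sum_nat_const; apply: leq_sum => a; rewrite inE => /andP[].
  apply: (@leq_trans (\sum_a #|span a|)).
    by rewrite big_mkcond /=; apply: leq_sum => a _; case: ifP.
  apply: (@leq_trans (\sum_v #|cols v|)); last first.
    by rewrite mulnC -sum_nat_const; apply: leq_sum.
  under eq_bigr do rewrite -sum1_card big_mkcond /=.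
  rewrite exchange_big /=; apply: leq_sum => v _.
  by rewrite -sum1_card [leqRHS]big_mkcond; apply: leq_sum => a _; rewrite spanE.
have L0 : 0 < L by apply: leq_trans L_large; rewrite addn_gt0 k_gt0 orbT.
have TL : #|T| < 2 * k * L.+1.
  by rewrite mulnC; apply: ltn_ceil; rewrite muln_gt0.
rewrite -(leq_pmul2r L0); apply: leq_trans le _.
apply: (@leq_trans (k * (2 * k * L.+1))); first by rewrite leq_mul2l (ltnW TL) orbT.
have -> : k * (2 * k * L.+1) = k ^ 2 * (2 * L.+1) by ring.
have -> : 4 * k ^ 2 * L = k ^ 2 * (4 * L) by ring.
by rewrite leq_mul2l; apply/orP; right; move: L0; slia.
Qed.

(** Either all vertices of some big colour see a second one, or two big colours
    both span more than half of the vertices and overlap in at least L. *)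
Let many_doubly_big : 1 < #|B| -> L <= #|[set v | 1 < #|bigs v|]|.
Proof.
case/card_gt1P=> a [b [aB bB ab]]; set Y := [set v | _].
have Bspan d : d \in B -> L <= #|span d| by rewrite inE => /andP[].
have one d : d \in B -> span d \subset Y \/ #|T| <= #|span d| + k.-1 * L.
  move=> dB; case: (boolP (span d \subset Y)) => [|/subsetPn[v vd vY]]; first by left.
  right; apply: (@unique_big v).
  have dv : d \in bigs v by rewrite inE -spanE vd Bspan.
  apply/eqP; rewrite eq_sym eqEcard sub1set dv cards1.
  by move: vY; rewrite inE -leqNgt.
have [sY|la] := one a aB; first exact: leq_trans (Bspan a aB) (subset_leq_card sY).
have [sY|lb] := one b bB; first exact: leq_trans (Bspan b bB) (subset_leq_card sY).
have sI : span a :&: span b \subset Y.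
  apply/subsetP=> v /setIP[va vb]; rewrite inE; apply/card_gt1P; exists a, b.
  by rewrite !inE -!spanE va vb !Bspan.
apply: leq_trans (subset_leq_card sI).
have := cardsUI (span a) (span b); have := max_card (mem (span a :|: span b)).
have kL : 2 * k * L = 2 * (L + k.-1 * L) by rewrite -mulSn prednK // mulnA.
by move: la lb L_small; rewrite kL; move: (k.-1 * L) => x; slia.
Qed.

(** If there is only one big colour, the representatives of the small colours
    suffice.  Otherwise at least L vertices see two big colours; their degree in
    the graph of the representatives is at most k - 2, which leaves room for
    additional disjoint edges, one fewer than there are big colours. *)
Lemma star_colours_le :
  exists E : {set {set T}},
    [/\ E \subset complete T, forall v, #|star E v| < k & #|c @: complete T| <= #|E| + 1].
Proof.
pose S := [set e in complete T | c e \notin B].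
have [G [sG cG eG]] := transversal_of c S.
have sGc : G \subset complete T.
  by apply: subset_trans sG _; apply/subsetP=> e; rewrite inE => /andP[].
have cardG : #|c @: complete T| = #|G| + #|B|.
  rewrite -(card_in_imset cG) eG -(cardsID B (c @: complete T)) addnC.
  congr (_ + _); last first.
    by apply: eq_card => a; rewrite !inE; case: (a \in _ @: _); rewrite ?andbT ?andbF //= andbb.
  apply: eq_card => a; rewrite in_setD; apply/andP/imsetP => [[aB /imsetP[e ce ae]]|[e]].
    by exists e; rewrite // inE ce -ae.
  by rewrite inE => /andP[ce eB] ->; rewrite eB imset_f.
have starG v : #|star G v| + #|bigs v| <= k.
  apply: leq_trans (cols_le v); rewrite -(cardsID (bigs v) (cols v)) addnC.
  have sb : bigs v \subset cols v by apply/subsetP=> a; rewrite inE => /andP[].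
  rewrite (setIidPr sb) leq_add2l -(@card_in_imset _ _ c (star G v)); last first.
    by move=> e f; rewrite !inE => /andP[eG' _] /andP[fG _]; apply: cG.
  apply/subset_leq_card/subsetP=> _ /imsetP[e + ->]; rewrite inE => /andP[eG' ve].
  have /setIdP[ce eB] := subsetP sG e eG'; rewrite in_setD; apply/andP; split.
    by apply: contra eB => /setIdP[_ big]; rewrite inE big andbT; apply: imset_f.
  by apply: imset_f; rewrite inE ce.
have starG1 v : #|star G v| < k.
  by have := starG v; have := bigs_gt0 v; slia.
case: (leqP #|B| 1) => [B1|B2].
  by exists G; split; rewrite // cardG leq_add2l.
have Yst : {in [set v | 1 < #|bigs v|], forall v, #|star G v| + 2 <= k}.
  by move=> v; rewrite inE => lt; apply: leq_trans (starG v); rewrite leq_add2l.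
have cY : 2 * #|B|.-1 + k <= #|[set v | 1 < #|bigs v|]|.
  apply: leq_trans (many_doubly_big B2); apply: leq_trans L_large.
  by move: card_B; move: (k ^ 2) => x; slia.
have [E [sE dE cE]] := add_matching sGc starG1 Yst cY.
by exists E; split; rewrite // cE cardG; move: B2; slia.
Qed.

End StarColouring.

(** * The theorem *)

(** An edge of a fan lies in only one of its cliques; remove that clique. *)
Lemma has_fan_drop (T : finType) (G E : {set {set T}}) k s :
  has_fan G k.+1 s ->
  {in G &, forall e f, e \notin E -> f \notin E -> e = f} -> has_fan E k s.
Proof.
move=> [v [C [cC vC clC dC]]] one.
have bad i : ~~ clique E (v |: C i) ->
    exists x y, [/\ x \in v |: C i, y \in v |: C i, x != y, [set x; y] \in G & [set x; y] \notin E].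
  rewrite negb_forall_in => /exists_inP[x xC]; rewrite negb_forall_in => /exists_inP[y yC].
  rewrite negb_imply => /andP[xy nE]; exists x, y; split=> //.
  by have /cliqueP := clC i; apply.
have disj i j x : i != j -> x \in v |: C i -> x \in v |: C j -> x = v.
  move=> /dC/pred0P/(_ x) /= dx /setU1P[//|xi] /setU1P[//|xj].
  by rewrite xi xj in dx.
have two_bad i j : i != j -> ~~ clique E (v |: C i) -> clique E (v |: C j).
  move=> ij /bad[x [y [xC yC xy xyG xyE]]]; apply: contraT => /bad[a [b [aC bC _ abG abE]]].
  have eq2 := one _ _ xyG abG xyE abE.
  have inj z : z \in [set x; y] -> z \in v |: C j.
    by rewrite eq2 => /set2P[]->.
  by rewrite (disj i j x) ?inj ?set21 // (disj i j y) ?inj ?set22 // eqxx in xy.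
have [i0 good] : exists i0, forall i, i != i0 -> clique E (v |: C i).
  case: (boolP [exists i, ~~ clique E (v |: C i)]) => [/existsP[i0 bi0]|].
    by exists i0 => i ii0; apply: two_bad bi0; rewrite eq_sym.
  by rewrite negb_exists => /forallP h; exists ord0 => i _; have := h i; rewrite negbK.
exists v, (fun i => C (lift i0 i)); split=> // [i|i j ij].
  by apply: good; rewrite eq_sym neq_lift.
by apply: dC; rewrite (inj_eq lift_inj).
Qed.

Lemma ex_witness n k r : 0 < k -> 1 < r ->
  exists E : {set {set 'I_n}},
    [/\ E \subset complete 'I_n, ~ has_fan E k r.-1 & #|E| = ex n (fan k r)].
Proof.
move=> k0 r1; pose P (E : {set {set 'I_n}}) := simple_graph E && ~~ contains E (fan k r).
have P0 : P set0.
  rewrite /P /simple_graph sub0set /=; apply/negP=> /contains_fanP[v [C [cC vC clC _]]].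
  have /card_gt0P[x xC] : 0 < #|C (Ordinal k0)| by rewrite cC; case: (r) r1 => [|[]].
  have /cliqueP/(_ v x) := clC (Ordinal k0).
  rewrite setU11 in_setU1 xC orbT inE => /(_ isT isT) h; suff : false by [].
  by apply: h; apply: contraNneq (vC (Ordinal k0)) => ->.
have [|E] := @eq_bigmax_cond _ P (fun E => #|E|).
  by apply/card_gt0P; exists set0.
move=> /andP[sE nE] eE; exists E; split=> //.
by move/contains_fanP; apply/negP.
Qed.

Lemma complete_has_fan n k r : (r.-1 * k).+1 <= n -> has_fan (complete 'I_n) k r.-1.
Proof.
rewrite -card_fan_vertex => le; apply/contains_fanP/existsP.
pose f := [ffun x : fan_vertex k r => widen_ord le (enum_rank x)].
have f_inj : injective f.
  move=> x y; rewrite !ffunE => /(congr1 \val) /= /ord_inj; exact: enum_rank_inj.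
exists f; apply/andP; split; first exact/injectiveP.
apply/subsetP=> _ /imsetP[e + ->]; rewrite !inE => /andP[ce _].
by rewrite card_imset.
Qed.

(** Colour an extremal graph E injectively and all other edges with one more
    colour.  A rainbow fan has at most one edge outside E, so dropping one clique
    leaves a fan with k cliques in E.  For smaller m, colours of E are merged into
    the last one. *)
Lemma not_forced n k r m :
  0 < k -> 1 < r -> (r.-1 * k).+1 <= n -> 0 < m <= ex n (fan k r) + 1 ->
  ~~ forces_rainbow n (fan k.+1 r) m.
Proof.
move=> k0 r1 nk /andP[m0 mE]; have [E [sE nE cE]] := ex_witness n k0 r1.
case: m m0 mE => // m _; rewrite addn1 ltnS -cE => mE.
rewrite /forces_rainbow /= negb_forall; apply/existsP.
pose w (e : {set 'I_n}) := if e \in E then minn (index e (enum E)) m else m.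
have wm e : w e < m.+1 by rewrite /w; case: ifP; rewrite ltnS ?geq_minr.
exists [ffun e => Ordinal (wm e)]; rewrite negb_imply; apply/andP; split.
  rewrite /exact_coloring eqEsubset subsetT; apply/subsetP=> i _.
  have [lt|ge] := ltnP i m.
    have iE : i < size (enum E) by rewrite -cardE; apply: leq_trans mE.
    have eE : nth set0 (enum E) i \in E by rewrite -mem_enum mem_nth.
    apply/imsetP; exists (nth set0 (enum E) i); first exact: (subsetP sE).
    apply/val_inj; rewrite ffunE /= /w eE index_uniq ?enum_uniq //.
    by apply/esym/minn_idPl/ltnW.
  have /subsetPn[e ce eE] : ~~ (complete 'I_n \subset E).
    by apply/negP=> /has_fanS h; apply/nE/h/complete_has_fan.
  apply/imsetP; exists e => //; apply/val_inj; rewrite ffunE /= /w (negPf eE).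
  by apply/eqP; rewrite eqn_leq ge -ltnS ltn_ord.
apply/negP=> /existsP[f /and3P[f_inj fc /dinjectiveP rb]]; apply: nE.
have fan_copy : has_fan (copy (fan k.+1 r) f) k.+1 r.-1.
  by apply/contains_fanP/existsP; exists f; rewrite f_inj subxx.
apply: has_fan_drop fan_copy _ => e e' eC eC' eE eE'.
apply: rb => //; apply/val_inj; by rewrite !ffunE /= /w (negPf eE) (negPf eE').
Qed.

(** A graph with one representative of each colour is rainbow and has two edges
    more than an extremal graph. *)
Lemma forced n k r :
  0 < k -> 1 < r -> 256 * (k + 1) ^ 5 * r ^ 16 <= n ->
  forces_rainbow n (fan k.+1 r) (ex n (fan k r) + 2).
Proof.
move=> k0 r1 hn; rewrite /forces_rainbow addn2 /=.
apply/forallP=> c; apply/implyP=> /eqP onto; apply: contraT => none.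
have free (G : {set {set 'I_n}}) :
    G \subset complete 'I_n -> {in G &, injective c} -> ~ has_fan G k.+1 r.-1.
  move=> sG cG /contains_fanP/existsP[f /andP[f_inj fG]].
  case/existsP: none; exists f; rewrite f_inj (subset_trans fG sG) /=.
  apply/dinjectiveP=> e e' eC eC'; apply: cG; exact: (subsetP fG).
have card_c : #|c @: complete 'I_n| = (ex n (fan k r)).+2 by rewrite onto cardsT card_ord.
case: r r1 hn c onto none free card_c => // p p0 hn c onto none free card_c.
have [p1|p1] := leqP p 1.
  have {p0 p1} pE : p = 1 by apply/eqP; rewrite eqn_leq p1.
  subst p.
  have big : 2 * k * (8 * k ^ 2 + k) <= #|'I_n|.
    rewrite card_ord; apply: leq_trans hn; apply: (@leq_trans (256 * (k + 1) ^ 5)).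
      apply: (@leq_trans (256 * (k + 1) ^ 3)); first by clear -k0; nia.
      by rewrite leq_mul2l leq_pexp2l // addn1.
    by rewrite leq_pmulr // expn_gt0.
  have [E [sE dE le]] := star_colours_le k0 free big.
  rewrite card_c addn1 ltnS in le.
  by have := leq_trans le (ex_star sE dE); rewrite ltnn.
have [G [sG cG eG]] := transversal_of c (complete 'I_n).
exfalso; apply: (rainbow_fan_dense k0 p1 hn sG cG _ free).
by rewrite -(card_in_imset cG) eG card_c addn2.
Qed.

Theorem theorem1 (n k r : nat) (hk : 1 <= k) (hr : 2 <= r)
    (hn : 256 * (k + 1) ^ 5 * r ^ 16 <= n) :
  ar n (fan (k + 1) r) = ex n (fan k r) + 2.
Proof.
have fan_fits : (r.-1 * k).+1 <= n.
  apply: leq_trans hn; apply: (@leq_trans (k.+1 * r)).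
    by case: r hr => // r' _ /=; nia.
  apply: leq_mul; last by rewrite -{1}[r]expn1 leq_pexp2l // ltnW.
  rewrite -[k.+1]mul1n; apply: leq_mul => //.
  by rewrite addn1 -{1}[k.+1]expn1 leq_pexp2l.
rewrite [in LHS]addn1 /ar; case: ex_minnP => m fm minm.
apply/eqP; rewrite eqn_leq minm ?forced //=.
have m0 : 0 < m by case/andP: fm.
rewrite leqNgt; apply: contraL fm => lt; apply: not_forced => //.
by rewrite m0 addn1 -ltnS -addn2.
Qed.
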